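(* Let $\bar B=(B_n)_{n\ge 1}$ be a sequence of independent two-sided Brownian motions defined on a probability space $\Omega$. For $\omega\in\Omega$ write $\bar B(\omega)=(B_n(\omega,\cdot))_{n\ge 1}$. Then: (i) The sequence $\bar B$ determines a non-degenerate continuum with probability $1$. (ii) The continuum $K(\bar B)$ determined by $\bar B$ is indecomposable with probability $1$. Explicitly, the set of all $\omega\in\Omega$ such that $B_n(\omega,\cdot)$ is continuous for each $n\ge 1$, the sequence $\bar B(\omega)$ determines a non-degenerate continuum, and the continuum $K(\bar B(\omega))$ determined by $\bar B(\omega)$ is indecomposable, has measure $1$.
   Context: $\mathbb{N}$ is the set of positive integers. Brownian motion. A (standard, one-dimensional) Brownian motion is a measurable function $B\colon\Omega\times[0,\infty)\to\mathbb{R}$, where $\Omega$ is a probability space (measurability with respect to the product measure, $[0,\infty)$ carrying Lebesgue measure), such that, writing $B(t)=B(\cdot,t)$: $B(\omega,0)=0$ for all $\omega$; $B(\omega,\cdot)$ is continuous for almost every $\omega$; for $t_0<\dots<t_k$ the increments $B(t_i)-B(t_{i-1})$, $i=1,\dots,k$, are independent; and for $s<t$ the increment $B(t)-B(s)$ has the same distribution as $B(t-s)$, namely the normal distribution with mean $0$ and variance $t-s$. A two-sided Brownian motion is a process $B=(B(t),t\in\mathbb{R})$ given by $B(t)=B_+(t)$ for $t\ge 0$ and $B(t)=B_-(-t)$ for $t<0$, where $B_+$ and $B_-$ are two independent standard Brownian motions. Statements ''with probability $1$'' and ''of measure $1$'' are understood with respect to the completion of the probability measure, i.e. the set in question contains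 a measurable set of probability $1$. Intervals. An interval is a set $\{x\in\mathbb{R}: a\le x\le b\}$ with $a,b\in\mathbb{R}$, $a\le b$; it is non-degenerate if $a<b$. For intervals $I,J$ let $\mathrm{dist}(I,J)=\max(|\min I-\min J|,|\max I-\max J|)$ (the Hausdorff distance); $\lim_n I_n=J$ means $\lim_n\mathrm{dist}(I_n,J)=0$. Continua. A continuum is a (nonempty) compact connected metric space. A continuum $C$ is indecomposable if whenever $C=C_1\cup C_2$ with $C_1,C_2$ subcontinua of $C$, then $C_1=C$ or $C_2=C$. Sequences determining a continuum. Let $\bar f=(f_n)_{n\ge1}$ be a sequence of continuous functions $f_n\colon\mathbb{R}\to\mathbb{R}$ with $f_n(0)=0$. The sequence $\bar f$ determines a continuum if there exists a sequence $(I_n)_{n\ge1}$ of intervals with $0\in I_n$ such that, for each non-degenerate interval $J$ with $0\in J$ and each $k\ge1$, $$I_k=\lim_{n}\,(f_k\circ f_{k+1}\circ\cdots\circ f_{k+n})(J).$$ The sequence $(I_n)$ is then uniquely determined by $\bar f$, and $f_k(I_{k+1})=I_k$ for each $k\ge1$. The sequence $\bar f$ determines a non-degenerate continuum if, in addition, $I_n$ is non-degenerate for all but finitely many $n$. The continuum determined by $\bar f$ is the inverse limit $$K(\bar f)=\varprojlim_n(I_n,f_n\restriction I_{n+1})=\{(x_1,x_2,\dots)\in\mathbb{R}^{\mathbb{N}}:\ x_n\in I_n\text{ and }f_n(x_{n+1})=x_n\text{ for all }n\in\mathbb{N}\},$$ with the topology inherited from the product topology on $\mathbb{R}^{\mathbb{N}}$.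 *)

(* Defs.v *)
(* MathComp-Analysis, over an arbitrary [R : realType].  Sequences indexed by
   the positive integers are indexed from 0 here: the [n]-th term in this file
   is the [(n+1)]-st term of the usual numbering. *)
From HB Require Import structures.
From mathcomp Require Import all_boot all_order all_algebra.
From mathcomp Require Import all_classical all_reals all_analysis.
From mathcomp Require Import measurable_realfun.

Set Implicit Arguments.
Unset Strict Implicit.
Unset Printing Implicit Defensive.

Import Order.TTheory GRing.Theory Num.Theory.
Import numFieldNormedType.Exports.

Local Open Scope classical_set_scope.
Local Open Scope ring_scope.

Section independence.
Context (R : realType) (d : measure_display) (Omega : measurableType d).
Variable P : probability Omega R.

(* The product rule is required for every finite subfamily. *)
Definition independent_families (I : eqType) (F : I -> set (set Omega)) :=
  forall (s : seq I) (E : I -> set Omega), uniq s ->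
    (forall i, i \in s -> F i (E i)) ->
    (P (\bigcap_(i in [set` s]) E i) = \prod_(i <- s) P (E i))%E.

Definition independent_rvs (I : eqType) (X : I -> Omega -> R) :=
  independent_families (fun i => preimage_set_system setT (X i) measurable).

(* The sigma-algebra generated by [B t], [t] in [D]. *)
Definition process_sigma (D : set R) (B : Omega -> R -> R) : set (set Omega) :=
  <<s \bigcup_(t in D) preimage_set_system setT (B ^~ t) measurable >>.

Definition independent_processes (I : eqType) (D : set R)
    (B : I -> Omega -> R -> R) :=
  independent_families (fun i => process_sigma D (B i)).

End independence.

Section brownian.
Context (R : realType) (d : measure_display) (Omega : measurableType d).
Variable P : probability Omega R.

(* A process indexed by [0, +oo) is a function [Omega -> R -> R] of which only
   the values at times [t >= 0] are constrained or used.

   Joint measurability is with respect to the completion of the product of [P]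
   and the Lebesgue measure on [0, +oo); since such completion-measurability
   does not control individual time sections, that each [B t] is a random
   variable on [Omega] is stated separately.  (For joint measurability with
   respect to the uncompleted product sigma-algebra it is automatic.) *)
Record brownian_motion (B : Omega -> R -> R) : Prop := BrownianMotion {
  bm_jointly_measurable : forall Y : set R, measurable Y ->
    completed_algebra_gen (P \x (@lebesgue_measure R))%E
      [set wt : Omega * R | 0 <= wt.2 /\ Y (B wt.1 wt.2)] ;
  bm_measurable : forall t, 0 <= t -> measurable_fun setT (B ^~ t) ;
  bm_start : forall w, B w 0 = 0 ;
  bm_continuous : {ae P, forall w, {within `[0, +oo[, continuous (B w)}} ;
  bm_independent_increments : forall (k : nat) (t : nat -> R), 0 <= t 0%N ->
    (forall i, (i < k)%N -> t i < t i.+1) ->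
    independent_rvs P (fun (i : 'I_k) w => B w (t i.+1) - B w (t i)) ;
  bm_stationary_increments : forall s t, 0 <= s -> s < t ->
    forall Y : set R, measurable Y ->
      P ((fun w => B w t - B w s) @^-1` Y) = P ((B ^~ (t - s)) @^-1` Y) ;
  (* the second argument of [normal_prob] is the standard deviation *)
  bm_normal_increments : forall s t, 0 <= s -> s < t ->
    forall Y : set R, measurable Y ->
      P ((fun w => B w t - B w s) @^-1` Y)
      = normal_prob 0 (Num.sqrt (t - s)) Y }.

Definition two_sided_brownian_motion (B : Omega -> R -> R) :=
  exists Bp Bm : Omega -> R -> R,
    [/\ brownian_motion Bp, brownian_motion Bm,
        independent_processes P [set t | 0 <= t]
          (fun b : bool => if b then Bp else Bm)
      & forall w t, B w t = if 0 <= t then Bp w t else Bm w (- t)].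

End brownian.

Section determined_continuum.
Context (R : realType).

Definition segment (J : set R) := exists a b, a <= b /\ J = `[a, b]%classic.

Definition nondegenerate_segment (J : set R) :=
  exists a b, a < b /\ J = `[a, b]%classic.

(* On segments [inf] and [sup] are the minimum and the maximum. *)
Definition segment_dist (I J : set R) : R :=
  Num.max `|inf I - inf J| `|sup I - sup J|.

(* [f_k \o f_{k+1} \o ... \o f_{k+n}] *)
Fixpoint iter_comp (f : nat -> R -> R) (k n : nat) : R -> R :=
  if n is m.+1 then f k \o iter_comp f k.+1 m else f k.

(* Meant for continuous [f n] with [f n 0 = 0], for which every image below is
   a segment containing 0. *)
Definition determines_segments (f : nat -> R -> R) (I : nat -> set R) :=
  [/\ forall k, segment (I k), forall k, I k 0
    & forall J, nondegenerate_segment J -> J 0 -> forall k,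
        segment_dist (iter_comp f k n @` J) (I k) @[n --> \oo] --> (0 : R)].

Definition determines_continuum (f : nat -> R -> R) :=
  exists I, determines_segments f I.

Definition determines_nondegenerate_continuum (f : nat -> R -> R) :=
  exists I, determines_segments f I /\
    \forall n \near \oo, nondegenerate_segment (I n).

Definition inverse_limit (I : nat -> set R) (f : nat -> R -> R) :
    set (prod_topology (fun _ : nat => R)) :=
  [set x | forall n, I n (x n) /\ f n (x n.+1) = x n].

(* The sequence [I] is chosen; it is unique by [determines_segments_unique]
   below.  If [f] determines no continuum the value is irrelevant (empty). *)
Definition determined_continuum (f : nat -> R -> R) :
    set (prod_topology (fun _ : nat => R)) :=
  inverse_limit (xget (fun=> set0) (determines_segments f)) f.

(* Metrizability is inherited from the countable product [R^nat]. *)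
Definition continuum (C : set (prod_topology (fun _ : nat => R))) :=
  [/\ C !=set0, compact C & connected C].

Definition indecomposable_continuum
    (C : set (prod_topology (fun _ : nat => R))) :=
  continuum C /\
  forall C1 C2, continuum C1 -> continuum C2 -> C = C1 `|` C2 ->
    C1 = C \/ C2 = C.

Lemma segment_dist_eq0 (I J : set R) :
  segment I -> segment J -> segment_dist I J = 0 -> I = J.
Proof.
move=> [a [b [ab ->]]] [a' [b' [ab' ->]]] /eqP.
rewrite /segment_dist !inf_itv ?bnd_simp// !sup_itv ?bnd_simp// => /eqP h.
have ha : `|a - a'| <= 0 by rewrite -h le_max lexx.
have hb : `|b - b'| <= 0 by rewrite -h le_max lexx orbT.
move: ha hb; rewrite !normr_le0 !subr_eq0 => /eqP -> /eqP -> //.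
Qed.

Lemma segment_dist_ge0 (I J : set R) : 0 <= segment_dist I J.
Proof. by rewrite le_max normr_ge0. Qed.

Lemma segment_dist_triangle (I J K : set R) :
  segment_dist J K <= segment_dist I J + segment_dist I K.
Proof.
rewrite /segment_dist ge_max; apply/andP; split.
  apply: (le_trans (ler_distD (inf I) _ _)); rewrite (distrC (inf J)).
  by apply: lerD; rewrite le_max lexx.
apply: (le_trans (ler_distD (sup I) _ _)); rewrite (distrC (sup J)).
by apply: lerD; rewrite le_max lexx orbT.
Qed.

Lemma determines_segments_unique (f : nat -> R -> R) (I I' : nat -> set R) :
  determines_segments f I -> determines_segments f I' -> I = I'.
Proof.
move=> [sI I0 hI] [sI' I'0 hI']; apply/funext => k.
apply: segment_dist_eq0 => //; apply/eqP; rewrite eq_le segment_dist_ge0 andbT.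
have nJ : nondegenerate_segment `[(-1 : R), 1].
  by exists (-1), 1; split => //; apply: (@lt_trans _ _ 0).
have J0 : `[(-1 : R), 1]%classic 0 by rewrite /= in_itv/= lerN10 ler01.
have := cvgD (hI _ nJ J0 k) (hI' _ nJ J0 k); rewrite addr0 => h.
apply: (cvgr_to_ge (h _)); apply: nearW => n; exact: segment_dist_triangle.
Qed.

End determined_continuum.

(* Main.v *)
Require Import Defs.
From HB Require Import structures.
From mathcomp Require Import all_boot all_order all_algebra.
From mathcomp Require Import all_classical all_reals all_analysis.
From mathcomp Require Import measurable_realfun ring lra zify.
Import Order.TTheory GRing.Theory Num.Theory.
Import numFieldNormedType.Exports.
Local Open Scope classical_set_scope.
Local Open Scope ring_scope.

(** A Brownian path maps a segment of length L containing 0 onto a segment of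
    length about sqrt L, so each map halves the logarithm of the length, up to
    noise.  Hence long compositions bring every non-degenerate segment around 0
    to a moderate size, and at random places they even make all the images
    coincide.

    To make this precise, fix radii [D i] decreasing to 0 and [M i] increasing
    to infinity.  A place [j] of a sequence [f] is a pinching place
    ([pinching]) if two things hold.
    - For every [i], the map [f_(j+1+i)] sends [-M (i+1), M (i+1)] into
      [-M i, M i] and stretches either half of [-D (i+1), D (i+1)] over the
      whole of [-D i, D i].
    - All values of [f_j] on [-M 0, M 0] are already taken on [-D 0, D 0].
    By the first property the image of a non-degenerate segment [J] around 0
    under [f_(j+1) o ... o f_(j+n)] lies, for large [n], between [-D 0, D 0]
    and [-M 0, M 0]; by the second one [f_j] maps all such segments onto the
    same one.  So if there are infinitely many pinching places, then
    [f_k o ... o f_(k+n) (J)] is eventually constant in [n] and independent of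
    [J] ([near_image_iter_comp]), and its value is non-degenerate for large [k]
    because it contains some [-D i, D i].

    Let now [K] be the inverse limit and [K = C1 U C2] with subcontinua
    [C1], [C2] such that the constant sequence 0 is in [C1].  At a pinching
    place [j] there are two cases ([pinching_dichotomy]).  If the coordinate
    [j+2] of [C1] reaches [D 1] or [-D 1], then that projection contains half
    of [-D 1, D 1], and the two properties force [C1] to project onto the whole
    [j]-th segment.  Otherwise [C2] has points on both sides of the projection
    of [C1], which is therefore covered by the projection of [C2].  One case
    occurs infinitely often, and a subcontinuum with infinitely many full
    projections is [K].

    It remains to find infinitely many pinching places almost surely.  With
    [D i = 2^-(8 (n0+i)^2)] and [M i = 4^(n0+i)] the first property fails for a
    given [i] with probability at most [C q^(n0+i)], [q < 1]: the upper bound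
    comes from dyadic chaining ([not_tame_prob]), the lower one from sampling
    the path at times so far apart that it starts almost afresh at each of them
    ([not_overshoots_prob]).  The second property has positive probability: the
    path may make a big zigzag before time [D 0] and stay in a narrow band
    afterwards ([collapses_prob]).  Being a pinching place depends on infinitely
    many paths, so it is truncated to the paths with index in
    [[2^k, 2^(k+1)[].  The truncated events are independent with probabilities
    bounded below, hence infinitely many of them occur ([frequently_block]),
    while the discarded conditions have summable failure probabilities, hence
    fail finitely often ([finitely_many_tail_failures]). *)

(** * Pinching places of a sequence of maps *)

Set Implicit Arguments.
Unset Strict Implicit.
Unset Printing Implicit Defensive.

Section pinching.
Context (R : realType).
Implicit Types (f : nat -> R -> R) (g : R -> R) (J : set R) (M D : nat -> R).

Lemma iter_compD f k n m :
  iter_comp f k (n.+1 + m) = iter_comp f k n \o iter_comp f (k + n).+1 m.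
Proof.
elim: n k => [|n IH] k; first by rewrite add1n addn0.
rewrite -[iter_comp f k (n.+2 + m)]/(f k \o iter_comp f k.+1 (n.+1 + m)).
by rewrite IH addSnnS.
Qed.

Lemma continuous_iter_comp f k n :
  (forall i, continuous (f i)) -> continuous (iter_comp f k n).
Proof.
move=> cf; elim: n k => [|n IH] k /=; first exact: cf.
move=> x; apply: continuous_comp; [exact: IH|exact: cf].
Qed.

Lemma iter_comp0 f k n : (forall i, f i 0 = 0) -> iter_comp f k n 0 = 0.
Proof. by move=> f0; elim: n k => [|n IH] k //=; rewrite IH. Qed.

Lemma image_segment g a b : continuous g -> a <= b ->
  exists c d, c <= d /\ g @` `[a, b] = `[c, d]%classic.
Proof.
move=> cg ab; have cgab : {within `[a, b], continuous g}.
  exact: continuous_subspaceT.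
have [u uab gu] := EVT_min ab cgab; have [v vab gv] := EVT_max ab cgab.
exists (g u), (g v); split; first exact: gu.
apply/seteqP; split=> [_ [x xab <-]|y /=].
  by rewrite /= in_itv/= gu ?gv.
rewrite in_itv /= => /andP[guy ygv].
have /connected_intervalP gI : connected (g @` `[a, b]).
  apply: connected_continuous_connected => //.
  by apply/connected_intervalP; exact: interval_is_interval.
apply: (gI (g u) (g v)); [by exists u|by exists v|].
by rewrite guy ygv.
Qed.

Definition between J a b := `[- a, a] `<=` J /\ J `<=` `[- b, b].

(** A non-degenerate segment containing 0 may have 0 as an end point, so only one
    half of [[- a, a]] can be asked for. *)
Definition one_sided_between J a b :=
  (`[0, a] `<=` J \/ `[- a, 0] `<=` J) /\ J `<=` `[- b, b].

(** Either half of the inner segment is stretched over both sides of 0: this is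
    what turns one-sided segments into two-sided ones. *)
Definition spreads g (a' b' a b : R) :=
  [/\ g @` `[- b', b'] `<=` `[- b, b], `[- a, a] `<=` g @` `[0, a']
    & `[- a, a] `<=` g @` `[- a', 0]].

Lemma between_one_sided J a b : 0 <= a -> between J a b -> one_sided_between J a b.
Proof.
move=> a0 [aJ Jb]; split=> //; left=> x /=; rewrite in_itv/= => /andP[x0 xa].
by apply: aJ; rewrite /= in_itv/= xa andbT (le_trans _ x0)// oppr_le0.
Qed.

Lemma spreads_between g a' b' a b J : spreads g a' b' a b ->
  one_sided_between J a' b' -> between (g @` J) a b.
Proof.
move=> [gb ga ga'] [aJ Jb]; split; last first.
  by apply: subset_trans gb; exact: image_subset.
by case: aJ => aJ; [apply: (subset_trans ga)|apply: (subset_trans ga')];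
  exact: image_subset.
Qed.

Lemma iter_comp_between f D M k n J : (forall i, 0 <= D i) ->
  (forall i, spreads (f (k + i)%N) (D i.+1) (M i.+1) (D i) (M i)) ->
  one_sided_between J (D n.+1) (M n.+1) ->
  between (iter_comp f k n @` J) (D 0%N) (M 0%N).
Proof.
elim: n k D M => [|n IH] k D M D0 fS JDM /=.
  by apply: spreads_between JDM; have := fS 0%N; rewrite addn0.
rewrite -image_comp; apply: spreads_between; last first.
  apply: between_one_sided; last first.
    apply: (IH k.+1 (D \o succn) (M \o succn)) => //= i.
    by rewrite addSnnS; exact: fS.
  exact: D0.
by have := fS 0%N; rewrite addn0.
Qed.

Lemma near_one_sided_between D M J : D @ \oo --> (0 : R) -> M @ \oo --> +oo ->
  nondegenerate_segment J -> J 0 ->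
  \forall n \near \oo, one_sided_between J (D n.+1) (M n.+1).
Proof.
move=> D0 Moo [a [b [ab ->]]] /=; rewrite in_itv/= => /andP[a0 b0].
have Mab : \forall n \near \oo, Num.max (- a) b <= M n.+1.
  move/cvgryPge : Moo => /(_ (Num.max (- a) b)) [N _ h].
  by exists N => // n /= Nn; apply: h => /=; exact: leqW.
have Dlt e : 0 < e -> \forall n \near \oo, D n.+1 < e.
  move=> e0; move/cvgrPdist_lt : D0 => /(_ _ e0) [N _ h].
  exists N => // n /= Nn; have /= := h n.+1 (leqW Nn).
  by rewrite sub0r normrN; exact/le_lt_trans/ler_norm.
have [b1|b1] := ltP 0 b.
  near=> n; split; last first.
    move=> x /=; rewrite !in_itv/= => /andP[ax xb].
    have : Num.max (- a) b <= M n.+1 by near: n.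
    by rewrite ge_max => /andP[aM bM]; lra.
  left=> x /=; rewrite !in_itv/=.
  have : D n.+1 < b by near: n; exact: Dlt.
  by lra.
have a1 : 0 < - a by lra.
near=> n; split; last first.
  move=> x /=; rewrite !in_itv/= => /andP[ax xb].
  have : Num.max (- a) b <= M n.+1 by near: n.
  by rewrite ge_max => /andP[aM bM]; lra.
right=> x /=; rewrite !in_itv/=.
have : D n.+1 < - a by near: n; exact: Dlt.
by lra.
Unshelve. all: by end_near. Qed.

(** The radii [D] and [M] are indexed by the distance to the place [j], so that
    the same sequences serve for every [j]. *)
Definition pinching D M f j :=
  f j @` `[- M 0%N, M 0%N] `<=` f j @` `[- D 0%N, D 0%N] /\
  forall i, spreads (f (j.+1 + i)%N) (D i.+1) (M i.+1) (D i) (M i).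

Lemma pinching_image D M f j J : pinching D M f j ->
  between J (D 0%N) (M 0%N) -> f j @` J = f j @` `[- D 0%N, D 0%N].
Proof.
move=> [pj _] [DJ JM]; apply/seteqP; split; last exact: image_subset.
by apply: subset_trans pj; exact: image_subset.
Qed.

End pinching.

(** * The segments determined by a frequently pinching sequence *)

Section determined_segments.
Context (R : realType) (f : nat -> R -> R) (D M : nat -> R).
Hypothesis cf : forall n, continuous (f n).
Hypothesis f0 : forall n, f n 0 = 0.
Hypothesis D_gt0 : forall n, 0 < D n.
Hypothesis D_cvg : D @ \oo --> (0 : R).
Hypothesis M_cvg : M @ \oo --> +oo.
Hypothesis io_pinching : forall k, exists2 j, (k <= j)%N & pinching D M f j.

(** The map at the pinching place forgets which segment of intermediate size it
    is applied to; whatever is composed after it cannot tell either. *)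
Lemma iter_comp_pinching k j S : (k <= j)%N -> pinching D M f j ->
  between S (D 0%N) (M 0%N) ->
  iter_comp f k (j - k) @` S = iter_comp f k (j - k) @` `[- D 0%N, D 0%N].
Proof.
move=> kj pj bS; have Sj := pinching_image pj bS.
case e : (j - k)%N => [|n].
  by have -> : k = j by lia.
have -> : iter_comp f k n.+1 = iter_comp f k n \o f j.
  by rewrite -[in LHS](addn0 n.+1) iter_compD /=; congr (_ \o f _); lia.
by rewrite -[LHS]image_comp -[RHS]image_comp Sj.
Qed.

Lemma near_image_iter_comp k j J : (k <= j)%N -> pinching D M f j ->
  nondegenerate_segment J -> J 0 ->
  \forall n \near \oo, iter_comp f k n @` J
                       = iter_comp f k (j - k) @` `[- D 0%N, D 0%N].
Proof.
move=> kj pj nJ J0.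
have [N _ hN] := near_one_sided_between D_cvg M_cvg nJ J0.
exists (N + (j - k).+1)%N => // n /= Nn.
have -> : n = ((j - k).+1 + (n - (j - k).+1))%N by lia.
rewrite iter_compD -image_comp; apply: iter_comp_pinching => //.
apply: iter_comp_between; last by apply: hN => /=; lia.
- by move=> i; exact: ltW.
- by move=> i; rewrite subnKC//; exact: pj.2.
Qed.

Lemma unit_segment : nondegenerate_segment (`[(-1 : R), 1]%classic).
Proof. by exists (-1), 1; split=> //; lra. Qed.

Lemma unit_segment0 : `[(-1 : R), 1]%classic 0.
Proof. by rewrite /= in_itv/=; lra. Qed.

(** Any pinching place [j >= k] gives the same segment, by
    [near_image_iter_comp]; one of them is chosen. *)
Definition limit_segment (k : nat) : set R :=
  let j := sval (cid2 (io_pinching k)) in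
  iter_comp f k (j - k) @` `[- D 0%N, D 0%N].

Lemma near_limit_segment k J : nondegenerate_segment J -> J 0 ->
  \forall n \near \oo, iter_comp f k n @` J = limit_segment k.
Proof.
rewrite /limit_segment; case: cid2 => j kj pj /= nJ J0.
exact: near_image_iter_comp.
Qed.

Lemma limit_segment_segment k : segment (limit_segment k).
Proof.
have D0 := D_gt0 0%N; have DD : - D 0%N <= D 0%N by lra.
have [c [d [cd e]]] := image_segment
  (@continuous_iter_comp _ f k (sval (cid2 (io_pinching k)) - k) cf) DD.
by exists c, d; split.
Qed.

Lemma limit_segment0 k : limit_segment k 0.
Proof.
exists 0; last exact: iter_comp0.
by have D0 := D_gt0 0%N; rewrite /= in_itv/=; lra.
Qed.

Lemma limit_segment_determined : determines_segments f limit_segment.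
Proof.
split; [exact: limit_segment_segment|exact: limit_segment0|].
move=> J nJ J0 k; apply/cvgrPdist_le => e e0.
apply: filterS (near_limit_segment k nJ J0) => n ->.
by rewrite /segment_dist !subrr normr0 maxxx subrr normr0 ltW.
Qed.

(** Both sides are values of compositions applied to one fixed segment, taken far
    enough for these values to be stationary. *)
Lemma image_limit_segment k : f k @` limit_segment k.+1 = limit_segment k.
Proof.
have [N _ hN] := near_limit_segment k unit_segment unit_segment0.
have [N' _ hN'] := near_limit_segment k.+1 unit_segment unit_segment0.
rewrite -(hN' (N + N')%N) /=; last by rewrite leq_addl.
rewrite [LHS]image_comp.
by rewrite -(hN (N + N').+1) //=; lia.
Qed.

(** The segments of index larger than [j] are themselves images under the maps
    that follow the place [j], so they inherit the bounds that hold there. *)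
Lemma limit_segment_between j i : pinching D M f j ->
  between (limit_segment (j.+1 + i)) (D i) (M i).
Proof.
move=> pj.
have [N _ hN] := near_limit_segment (j.+1 + i) unit_segment unit_segment0.
have [N' _ hN'] :=
  near_one_sided_between D_cvg M_cvg unit_segment unit_segment0.
rewrite -(hN (N + N')%N) /=; last by rewrite leq_addr.
have := @iter_comp_between _ f (fun n => D (i + n)%N) (fun n => M (i + n)%N)
  (j.+1 + i) (N + N') `[(-1), 1]%classic.
rewrite !addn0; apply.
- by move=> n; exact: ltW.
- by move=> n; rewrite addnS -addnA; exact: pj.2.
- by rewrite addnS; apply: hN' => /=; lia.
Qed.

Lemma limit_segment_nondegenerate :
  \forall n \near \oo, nondegenerate_segment (limit_segment n).
Proof.
have [j _ pj] := io_pinching 0; exists j.+1 => // n /= jn.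
have [a [b [ab e]]] := limit_segment_segment n.
exists a, b; split=> //; rewrite lt_neqAle ab andbT; apply/eqP => eab.
have := (limit_segment_between (n - j.+1) pj).1; rewrite subnKC// e.
have D0 := D_gt0 (n - j.+1).
move=> h; have := h (D (n - j.+1)%N); have := h (- D (n - j.+1)%N).
rewrite /= !in_itv/= eab; lra.
Qed.

End determined_segments.

(** * Inverse limits of segments *)

Section inverse_limits.
Context (R : realType).
Notation T := (prod_topology (fun _ : nat => R)).
Implicit Types (f : nat -> R -> R) (I : nat -> set R) (C : set T).

Lemma continuous_coord n : continuous (fun x : T => x n).
Proof. exact: (@proj_continuous nat (fun=> R) n). Qed.

Lemma cvg_coord (x : nat -> T) (y : T) :
  (forall i, \forall n \near \oo, x n i = y i) -> x @ \oo --> y.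
Proof.
move=> xy; apply/cvg_sup => i A /= [_ [[B _ <-] By] BA].
by apply: filterS (xy i) => n xyi; apply: BA; rewrite /= /proj xyi.
Qed.

Lemma inverse_limit_coord_eq f I (x y : T) n m :
  inverse_limit I f x -> inverse_limit I f y ->
  (m <= n)%N -> x n = y n -> x m = y m.
Proof.
move=> Kx Ky; elim: n => [|n IH]; first by rewrite leqn0 => /eqP ->.
rewrite leq_eqVlt ltnS => /orP[/eqP->//|mn] xy; apply: IH => //.
by rewrite -(Kx n).2 -(Ky n).2 xy.
Qed.

(** Coordinate [n] of a point of an inverse limit determines all the previous ones,
    so points of [C] that agree with [x] at coordinate [n] converge to [x]. *)
Lemma closed_coord_surj f I C (x : T) : closed C -> C `<=` inverse_limit I f ->
  inverse_limit I f x -> (forall n, exists2 c, C c & c n = x n) -> C x.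
Proof.
move=> clC CK Kx h; pose c n := projT1 (cid2 (h n)).
have Cc n : C (c n) by rewrite /c; case: cid2.
have cx n : c n n = x n by rewrite /c; case: cid2.
apply: (@closed_cvg _ _ \oo _ c C clC); first exact: nearW.
apply: cvg_coord => i; exists i => // n /= ni.
by apply: (@inverse_limit_coord_eq f I _ _ n) => //; exact: CK.
Qed.

(** Preimages are chosen one after the other above coordinate [n], while the
    coordinates below [n] are forced. *)
Lemma inverse_limit_surj f I n y : (forall k, f k @` I k.+1 = I k) -> I n y ->
  exists2 x, inverse_limit I f x & x n = y.
Proof.
elim: n f I y => [|n IH] f I y fI Iy.
  pose pre k z := xget 0 [set t | I k.+1 t /\ f k t = z].
  pose fix x k := if k is k'.+1 then pre k' (x k') else y.
  have pre_spec k z : I k z -> I k.+1 (pre k z) /\ f k (pre k z) = z.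
    rewrite -(fI k) => -[t It tz].
    by apply: (@xgetPex _ 0 [set t | I k.+1 t /\ f k t = z]); exists t.
  have Ix k : I k (x k).
    by elim: k => [//|k IHk] /=; exact: (pre_spec k (x k) IHk).1.
  by exists x => // k; split=> //; exact: (pre_spec k (x k) (Ix k)).2.
have [x' Kx' x'n] := IH (fun k => f k.+1) (fun k => I k.+1) y (fun k => fI _) Iy.
exists (fun k => if k is k'.+1 then x' k' else f 0%N (x' 0%N)) => // -[|k].
  by split=> //; rewrite -(fI 0%N); exists (x' 0%N) => //; exact: (Kx' 0%N).1.
exact: Kx'.
Qed.

Section segments.
Variables (f : nat -> R -> R) (I : nat -> set R).
Hypothesis cf : forall n, continuous (f n).
Hypothesis I_seg : forall n, segment (I n).
Hypothesis fI : forall k, f k @` I k.+1 = I k.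
Notation K := (inverse_limit I f).

Lemma compact_segment (J : set R) : segment J -> compact J.
Proof. by move=> [a [b [_ ->]]]; exact: segment_compact. Qed.

Lemma compact_inverse_limit : compact K.
Proof.
have -> : K = [set x : T | forall n, I n (x n)]
              `&` (\bigcap_n [set x : T | f n (x n.+1) - x n = 0]).
  apply/seteqP; split=> [x Kx|x [Ix fx] n].
    split=> [n|n _]; first exact: (Kx n).1.
    by rewrite /= (Kx n).2 subrr.
  by split=> //; apply/eqP; rewrite -subr_eq0; apply/eqP/fx.
apply: compact_closedI; last first.
  apply: closed_bigI => n _; pose h (x : T) := f n (x n.+1) - x n.
  apply: (@preimage_closed T R h [set 0]);
    last exact: closed_eq.
  move=> x _; have xn := @continuous_coord n x.
  have fxn := continuous_comp (@continuous_coord n.+1 x) (@cf n (x n.+1)).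
  exact: (cvgB fxn xn).
by apply: (@tychonoff nat (fun=> R)) => n; exact: compact_segment.
Qed.

Lemma compact_coord n C : compact C -> compact ((fun x : T => x n) @` C).
Proof.
move=> cC; apply: continuous_compact => //.
by apply: continuous_subspaceT; exact: continuous_coord.
Qed.

Lemma closed_coord n C : compact C -> closed ((fun x : T => x n) @` C).
Proof. by move/(@compact_coord n)/compact_closed; apply; exact: Rhausdorff. Qed.

Lemma interval_coord n C : connected C -> is_interval ((fun x : T => x n) @` C).
Proof.
move=> cC; apply/connected_intervalP/connected_continuous_connected => //.
by apply: continuous_subspaceT; exact: continuous_coord.
Qed.

Lemma coord_inverse_limit n : (fun x : T => x n) @` K = I n.
Proof.
apply/seteqP; split=> [_ [x Kx <-]|y Iy]; first exact: (Kx n).1.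
by have [x Kx xy] := inverse_limit_surj fI Iy; exists x.
Qed.

(** If [A] is clopen with non-empty complement [A'], the projections of [A] and
    [A'] to each coordinate are compact and cover a connected set, so they meet.
    A cluster point of points of [A] with coordinate [n] in the projection of
    [A'] then belongs to both sets. *)
Lemma connected_inverse_limit : connected K.
Proof.
move=> A [a Aa] [ O oO AO] [F cF AF].
have cA : compact A by rewrite AF; exact: compact_closedI compact_inverse_limit cF.
pose A' := K `&` ~` O.
have cA' : compact A'.
  by apply: compact_closedI (open_closedC oO); exact: compact_inverse_limit.
apply/seteqP; split; first by rewrite AO => x [].
apply: contrapT => nKA.
have [b A'b] : A' !=set0.
  apply: contrapT => A'0; apply: nKA => x Kx; apply: contrapT => nAx.
  by apply: A'0; exists x; split=> // Ox; apply: nAx; rewrite AO.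
have KAA' n : I n = (fun x : T => x n) @` A `|` (fun x : T => x n) @` A'.
  rewrite -coord_inverse_limit -image_setU; congr (_ @` _).
  by rewrite AO /A' -setIUr setUv setIT.
have meet n : exists2 x, A x & ((fun x : T => x n) @` A') (x n).
  apply: contrapT => h.
  have AA' t : ((fun x : T => x n) @` A) t -> ~ ((fun x : T => x n) @` A') t.
    by move=> [x Ax <-] A'x; apply: h; exists x.
  have [c [d [_ Icd]]] := I_seg n.
  have Icon : connected (I n).
    by rewrite Icd; apply/connected_intervalP; exact: interval_is_interval.
  have IA : (fun x : T => x n) @` A = I n.
    apply: Icon.
    - by exists (a n); exists a.
    - exists (~` ((fun x : T => x n) @` A')).
        by apply: closed_openC; exact: closed_coord.
      rewrite KAA'; apply/seteqP; split=> [t At|t [[//|A't] nA't]//].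
      by split; [left|exact: AA'].
    - exists ((fun x : T => x n) @` A); first exact: closed_coord.
      rewrite KAA'; apply/seteqP; split=> [t At|t []//].
      by split=> //; left.
  apply: (AA' (b n)); last by exists b.
  by rewrite IA KAA'; right; exists b.
pose x n := projT1 (cid2 (meet n)).
have Ax n : A (x n) by rewrite /x; case: cid2.
have A'x n : ((fun x : T => x n) @` A') (x n n) by rewrite /x; case: cid2.
have xA : (x @ \oo) A by exists 0%N => // n _; exact: Ax.
have [p [Ap clp]] := cA (x @ \oo) _ xA.
have AK y : A y -> K y by rewrite AO => -[].
suff [_] : A' p by apply; move: Ap; rewrite AO => -[].
apply: (@closed_coord_surj f I A').
- apply: compact_closed => //.
  exact: (@hausdorff_product nat (fun=> R) (fun=> @Rhausdorff R)).
- by move=> y [].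
- exact: AK.
move=> i; pose E := (fun y : T => y i) @^-1` ((fun y : T => y i) @` A').
have cE : closed E.
  apply: preimage_closed; last exact: closed_coord.
  by move=> y _; exact: continuous_coord.
suff /cE [y A'y yp] : closure E p by exists y.
move=> U pU; apply: clp => //; exists i => // n /= ni.
have [y A'y yx] := A'x n; exists y => //.
exact: (inverse_limit_coord_eq A'y.1 (AK _ (Ax n)) ni yx).
Qed.

Lemma inverse_limit_frequently_onto C : compact C -> C `<=` K ->
  (forall k, exists2 n, (k <= n)%N & (fun x : T => x n) @` C = I n) -> C = K.
Proof.
move=> cC CK onto; apply/seteqP; split=> // x Kx.
apply: (@closed_coord_surj f I C) => //.
  apply: compact_closed => //.
  exact: (@hausdorff_product nat (fun=> R) (fun=> @Rhausdorff R)).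
move=> k; have [n kn Cn] := onto k.
have : I n (x n) by exact: (Kx n).1.
rewrite -Cn => -[c Cc cx]; exists c => //.
exact: (inverse_limit_coord_eq (CK _ Cc) Kx kn cx).
Qed.

End segments.
End inverse_limits.

(** * Indecomposability *)

Section pinching_indecomposable.
Context (R : realType) (f : nat -> R -> R) (D M : nat -> R).
Hypothesis cf : forall n, continuous (f n).
Hypothesis f0 : forall n, f n 0 = 0.
Hypothesis D_gt0 : forall n, 0 < D n.
Hypothesis D_cvg : D @ \oo --> (0 : R).
Hypothesis M_cvg : M @ \oo --> +oo.
Hypothesis io_pinching : forall k, exists2 j, (k <= j)%N & pinching D M f j.

Notation T := (prod_topology (fun _ : nat => R)).
Notation I := (limit_segment io_pinching).
Notation K := (inverse_limit I f).

Let I_seg k : segment (I k).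
Proof. exact: limit_segment_segment. Qed.

Let fI k : f k @` I k.+1 = I k.
Proof. exact: image_limit_segment. Qed.

Lemma image_coord (C : set T) n : C `<=` K ->
  f n @` ((fun x : T => x n.+1) @` C) = (fun x : T => x n) @` C.
Proof.
move=> CK; apply/seteqP; split=> [_ [_ [x Cx <-] <-]|_ [x Cx <-]].
  by exists x => //; rewrite (CK _ Cx n).2.
by exists (x n.+1); [exists x|exact: (CK _ Cx n).2].
Qed.

(** The two maps between coordinates [j+2] and [j] act in turn: the first makes
    the projection two-sided, the second one forgets its size. *)
Lemma pinching_coord_onto (C : set T) j : pinching D M f j -> C `<=` K ->
  one_sided_between ((fun x : T => x j.+2) @` C) (D 1%N) (M 1%N) ->
  (fun x : T => x j) @` C = I j.
Proof.
move=> pj CK bC; rewrite -image_coord// -image_coord//.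
rewrite -(fI j) (pinching_image pj); last first.
  by apply: spreads_between bC; have := pj.2 0%N; rewrite addn0.
rewrite (pinching_image pj) //.
have := limit_segment_between D_gt0 D_cvg M_cvg io_pinching 0 pj.
by rewrite addn0.
Qed.

Lemma coord_subset (C : set T) n : C `<=` K -> (fun x : T => x n) @` C `<=` I n.
Proof. by move=> CK _ [x /CK Kx <-]; exact: (Kx n).1. Qed.

(** Both projections are intervals.  If the one of [C1] avoids both of [D 1] and
    [- D 1], it lies strictly between them while these two points, and all
    points beyond, are in the one of [C2]. *)
Lemma pinching_dichotomy (C1 C2 : set T) j : pinching D M f j ->
  connected C1 -> connected C2 -> K = C1 `|` C2 -> C1 (fun=> 0) ->
  (fun x : T => x j) @` C1 = I j \/ (fun x : T => x j.+2) @` C2 = I j.+2.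
Proof.
move=> pj con1 con2 K12 C10.
have C1K : C1 `<=` K by rewrite K12; left.
have C2K : C2 `<=` K by rewrite K12; right.
have [DI IM] := limit_segment_between D_gt0 D_cvg M_cvg io_pinching 1 pj.
rewrite addn1 in DI IM.
have D1 := D_gt0 1.
have int1 : is_interval ((fun x : T => x j.+2) @` C1) by exact: interval_coord.
have int2 : is_interval ((fun x : T => x j.+2) @` C2) by exact: interval_coord.
have A0 : ((fun x : T => x j.+2) @` C1) 0 by exists (fun=> 0).
have AM : (fun x : T => x j.+2) @` C1 `<=` `[- M 1%N, M 1%N].
  by apply: subset_trans IM; exact: coord_subset.
have [AD|nAD] := pselect (((fun x : T => x j.+2) @` C1) (D 1%N)).
  left; apply: pinching_coord_onto => //; split=> //; left=> x /=.
  by rewrite in_itv/=; exact: int1.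
have [AD'|nAD'] := pselect (((fun x : T => x j.+2) @` C1) (- D 1%N)).
  left; apply: pinching_coord_onto => //; split=> //; right=> x /=.
  by rewrite in_itv/=; exact: int1.
right; have I12 : I j.+2 `<=`
    (fun x : T => x j.+2) @` C1 `|` (fun x : T => x j.+2) @` C2.
  rewrite -image_setU -K12 coord_inverse_limit//.
have DD : - D 1%N <= D 1%N by lra.
have ID : I j.+2 (D 1%N) by apply: DI; rewrite /= in_itv/= lexx DD.
have ID' : I j.+2 (- D 1%N) by apply: DI; rewrite /= in_itv/= lexx DD.
have BD : ((fun x : T => x j.+2) @` C2) (D 1%N) by case: (I12 _ ID).
have BD' : ((fun x : T => x j.+2) @` C2) (- D 1%N) by case: (I12 _ ID').
apply/seteqP; split; first exact: coord_subset.
move=> y Iy; case: (I12 _ Iy) => // Ay.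
apply: (int2 (- D 1%N) (D 1%N)) => //.
have [ly|ly] := lerP (- D 1%N) y; last first.
  by exfalso; apply: nAD'; apply: (int1 y 0) => //; lra.
have [yl|yl] := lerP y (D 1%N) => //.
by exfalso; apply: nAD; apply: (int1 0 y) => //; lra.
Qed.

(** If [C1] projects onto its segment only finitely often, then the other case of
    the dichotomy holds at all later pinching places. *)
Lemma zero_subcontinuum_alternative (C1 C2 : set T) :
  continuum C1 -> continuum C2 -> K = C1 `|` C2 -> C1 (fun=> 0) ->
  C1 = K \/ C2 = K.
Proof.
move=> [_ cpt1 con1] [_ cpt2 con2] K12 C10.
have C1K : C1 `<=` K by rewrite K12; left.
have C2K : C2 `<=` K by rewrite K12; right.
have [onto|] := pselect (forall k, exists2 n,
  (k <= n)%N & (fun x : T => x n) @` C1 = I n).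
  by left; exact: inverse_limit_frequently_onto onto.
move=> /existsNP[k0 nonto]; right.
apply: inverse_limit_frequently_onto => // k.
have [j kj pj] := io_pinching (maxn k k0).
have [C1j|C2j] := pinching_dichotomy pj con1 con2 K12 C10.
  by exfalso; apply: nonto; exists j => //; lia.
by exists j.+2 => //; lia.
Qed.

Lemma frequently_pinching_indecomposable :
  determines_nondegenerate_continuum f /\
  indecomposable_continuum (determined_continuum f).
Proof.
have dI : determines_segments f I by exact: limit_segment_determined.
split; first by exists I; split=> //; exact: limit_segment_nondegenerate.
have -> : determined_continuum f = K.
  rewrite /determined_continuum; congr (inverse_limit _ f).
  apply: (determines_segments_unique _ dI).
  by apply: (xgetPex (fun=> set0)); exists I.
have K0 : K (fun=> 0) by move=> n; split=> //; exact: limit_segment0.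
split.
  split; [by exists (fun=> 0)|exact: compact_inverse_limit|].
  exact: connected_inverse_limit.
move=> C1 C2 cC1 cC2 K12; have := K0; rewrite K12 => -[C10|C20].
  by rewrite -K12; exact: zero_subcontinuum_alternative.
rewrite -K12; apply/or_comm; apply: zero_subcontinuum_alternative => //.
by rewrite setUC.
Qed.

End pinching_indecomposable.

(** * Tails and lower bounds for the normal distribution *)

Lemma measurable_absr_ge (R : realType) (u : R) :
  measurable [set x : R | u <= `|x|].
Proof.
have -> : [set x : R | u <= `|x|] = `]-oo, - u] `|` `[u, +oo[.
  apply/seteqP; split=> x /=; rewrite !in_itv/= andbT lerNr ler_normr.
    by case/orP; [right|left].
  by case=> ->; rewrite ?orbT.
exact: measurableU.
Qed.

Lemma measurable_scaled_ge (R : realType) (e u : R) :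
  measurable [set x : R | u <= e * x].
Proof.
have -> : [set x : R | u <= e * x] = ( *%R e) @^-1` `[u, +oo[%classic.
  by apply/seteqP; split=> x /=; rewrite in_itv/= andbT.
by rewrite -[_ @^-1` _]setTI; exact: mulrl_measurable.
Qed.

Section normal_estimates.
Context (R : realType).
Implicit Types s u x y m : R.

Lemma normal_peakE s : 0 < s -> normal_peak s = normal_peak 1 / s.
Proof.
move=> s0; rewrite /normal_peak expr1n mul1r -mulrnAr sqrtrM ?sqr_ge0//.
by rewrite sqrtr_sqr gtr0_norm// invfM mulrC.
Qed.

(** The square of [1 + y / 2 <= exp (y / 2)]. *)
Lemma expRN_le y : 0 < y -> expR (- y) <= 4 / y ^+ 2.
Proof.
move=> y0; rewrite expRN -[leRHS]invf_div lef_pV2 ?posrE ?expR_gt0 ?divr_gt0 ?exprn_gt0//.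
have -> : expR y = expR (y / 2) ^+ 2 by rewrite -expRM_natl; congr expR; lra.
have -> : y ^+ 2 / 4 = (y / 2) ^+ 2 by field.
rewrite ler_pXn2r ?nnegrE ?expR_ge0 ?divr_ge0 ?ltW//.
by have := expR_ge1Dx (y / 2); lra.
Qed.

(** Part of the Gaussian factor pays for the tail, and what is left is the density
    with twice the standard deviation:
    [exp (- x^2 / 2 s^2) = exp (- x^2 / 2 (2 s)^2) * exp (- 3 x^2 / 8 s^2)].
    Integrating it costs nothing. *)
Lemma normal_pdf_tail s u x : 0 < s -> 0 < u -> u <= `|x| ->
  normal_pdf 0 s x <= 64 * (s / u) ^+ 4 * normal_pdf 0 (2 * s) x.
Proof.
move=> s0 u0 ux; have s20 : 0 < 2 * s by lra.
rewrite !normal_pdfE ?gt_eqF// /normal_fun subr0.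
rewrite (normal_peakE s0) (normal_peakE s20).
have -> : - x ^+ 2 / (s ^+ 2 *+ 2)
    = - x ^+ 2 / ((2 * s) ^+ 2 *+ 2) + - (3 / 8 * (x / s) ^+ 2).
  by field; rewrite gt_eqF.
rewrite expRD.
have -> : 64 * (s / u) ^+ 4 *
  (normal_peak 1 / (2 * s) * expR (- x ^+ 2 / ((2 * s) ^+ 2 *+ 2))) =
  normal_peak 1 / s * (expR (- x ^+ 2 / ((2 * s) ^+ 2 *+ 2)) *
    (32 * (s / u) ^+ 4)).
  by field; rewrite !gt_eqF.
apply: ler_wpM2l; first by rewrite divr_ge0 ?normal_peak_ge0 1?ltW.
apply: ler_wpM2l; first exact: expR_ge0.
have us : 0 < (u / s) ^+ 2 by rewrite exprn_gt0 ?divr_gt0.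
have uxs : (u / s) ^+ 2 <= (x / s) ^+ 2.
  rewrite -[leRHS]real_normK ?num_real// normrM normfV (gtr0_norm s0).
  rewrite ler_sqr ?nnegrE ?divr_ge0 ?(ltW s0) ?(ltW u0)//.
  by rewrite ler_pM2r ?invr_gt0.
apply: (@le_trans _ _ (expR (- (3 / 8 * (u / s) ^+ 2)))).
  by rewrite ler_expR; lra.
apply: le_trans (expRN_le _) _; first lra.
have -> : 4 / (3 / 8 * (u / s) ^+ 2) ^+ 2 = 256 / 9 * (s / u) ^+ 4.
  by field; rewrite !gt_eqF.
by apply: ler_wpM2r; [rewrite exprn_ge0// divr_ge0 ?ltW|lra].
Qed.

Lemma normal_prob_tail s u : 0 < s -> 0 < u ->
  (normal_prob 0 s [set x : R | (u <= `|x|)%R] <= (64 * (s / u) ^+ 4)%:E)%E.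
Proof.
move=> s0 u0; have mA := measurable_absr_ge u.
have c0 : 0 <= 64 * (s / u) ^+ 4 by rewrite mulr_ge0 ?exprn_ge0 ?divr_ge0 ?ltW.
have mpdf t : measurable_fun setT (fun x => (normal_pdf 0 t x)%:E : \bar R).
  by apply/measurable_EFinP; exact: measurable_normal_pdf.
rewrite /normal_prob.
apply: (@le_trans _ _ (\int[lebesgue_measure]_(x in [set x : R | (u <= `|x|)%R])
    ((64 * (s / u) ^+ 4)%:E * (normal_pdf 0 (2 * s) x)%:E))%E).
  apply: ge0_le_integral => //.
  - by move=> x _; rewrite lee_fin normal_pdf_ge0.
  - by apply: measurable_funTS; exact: mpdf.
  - by apply: measurable_funTS; apply: measurable_funeM; exact: mpdf.
  - by move=> x /= ux; rewrite -EFinM lee_fin; exact: normal_pdf_tail.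
rewrite ge0_integralZl//; last 2 first.
- by apply: measurable_funTS; exact: mpdf.
- by move=> x _; rewrite lee_fin normal_pdf_ge0.
rewrite -[leRHS]mule1 lee_wpmul2l ?lee_fin//.
by rewrite -/(normal_prob _ _ _); exact: probability_le1.
Qed.

Lemma normal_prob_itv_ge s m x y : 0 < s -> x <= y -> - m <= x -> y <= m ->
  ((normal_peak 1 * ((y - x) / s) * expR (- (m / s) ^+ 2 / 2))%:E
     <= normal_prob 0 s `[x, y])%E.
Proof.
move=> s0 xy mx ym; rewrite /normal_prob.
pose c : R := normal_peak s * expR (- (m / s) ^+ 2 / 2).
have -> : (normal_peak 1 * ((y - x) / s) * expR (- (m / s) ^+ 2 / 2))%:E
  = (\int[lebesgue_measure]_(z in `[x, y]) (cst c%:E z))%E.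
  rewrite integral_cst//= lebesgue_measure_itv/= lte_fin.
  have [xy'|yx'] := ltP x y; last first.
    have -> : y = x by apply/eqP; rewrite eq_le xy yx'.
    by rewrite subrr mul0r mulr0 mul0r mule0.
  by rewrite -EFinD -EFinM /c (normal_peakE s0); congr (_%:E); ring.
apply: ge0_le_integral => //.
- by move=> z _; rewrite lee_fin mulr_ge0 ?normal_peak_ge0 ?expR_ge0.
- apply: measurable_funTS; apply/measurable_EFinP; exact: measurable_normal_pdf.
move=> z /=; rewrite in_itv/= => /andP[xz zy].
rewrite lee_fin normal_pdfE ?gt_eqF// /c; apply: ler_wpM2l; first exact: normal_peak_ge0.
rewrite /normal_fun subr0 ler_expR.
have -> : - z ^+ 2 / (s ^+ 2 *+ 2) = - (z / s) ^+ 2 / 2.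
  by field; rewrite gt_eqF.
rewrite ler_pM2r ?invr_gt0// lerN2 !expr_div_n ler_pM2r ?invr_gt0 ?exprn_gt0//.
rewrite -subr_ge0.
have -> : m ^+ 2 - z ^+ 2 = (m - z) * (m + z) by ring.
by apply: mulr_ge0; lra.
Qed.

End normal_estimates.

(** * Conditions on a single path *)

Section path_events.
Context (R : realType).
Implicit Types (g : R -> R) (s T c h e t : R).

(** The increments over the dyadic intervals of level [m] are at most the [m]-th
    term of a geometric series with sum [c].  The ratio 9/10 is a compromise:
    below 1 for the series to converge, and with a fourth power above 1/2 for
    the quartic Gaussian tail to beat the number [2 ^ m] of intervals. *)
Definition tame s T c g := forall m k, (k < 2 ^ m)%N ->
  `|g (s + T * k.+1%:R / 2 ^+ m) - g (s + T * k%:R / 2 ^+ m)|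
    <= c / 10 * (9 / 10) ^+ m.

Lemma tame_dyadic s T c g m k : 0 <= c -> tame s T c g -> (k <= 2 ^ m)%N ->
  `|g (s + T * k%:R / 2 ^+ m) - g s| <= c * (1 - (9 / 10) ^+ m.+1).
Proof.
move=> c0 tg; elim: m k => [|m IH] k kle.
  have [->|->] : k = 0%N \/ k = 1%N by rewrite expn0 in kle; lia.
    by rewrite mulr0 mul0r addr0 subrr normr0 expr1; lra.
  have := tg 0%N 0%N (ltnSn _).
  by rewrite mulr0 mul0r addr0 expr0 !mulr1 expr1; lra.
have p9 : 0 <= (9 / 10 : R) ^+ m.+1 by rewrite exprn_ge0//; lra.
have e9 : (9 / 10 : R) ^+ m.+1 = 9 / 10 * (9 / 10) ^+ m by rewrite exprS.
have e9' : (9 / 10 : R) ^+ m.+2 = 9 / 10 * (9 / 10) ^+ m.+1 by rewrite exprS.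
have cp : 0 <= c * (9 / 10 : R) ^+ m.+1 by rewrite mulr_ge0.
have even j : (j <= 2 ^ m)%N ->
    `|g (s + T * j.*2%:R / 2 ^+ m.+1) - g s| <= c * (1 - (9 / 10) ^+ m.+1).
  move=> jm; have -> : T * j.*2%:R / 2 ^+ m.+1 = T * j%:R / 2 ^+ m.
    rewrite -muln2 natrM exprS; field.
    by rewrite expf_neq0.
  exact: IH.
(* An even multiple is already a point of the previous level; an odd one is one
   increment away from it. *)
have [jo|je] := boolP (odd k).
  have kE : k = (k./2.*2).+1 by rewrite -[LHS]odd_double_half jo.
  have jm : (k./2 <= 2 ^ m)%N by move: kle; rewrite expnS; lia.
  have := even _ jm; have := tg m.+1 k./2.*2.
  rewrite -kE => /(_ kle) h1 h2.
  rewrite -(subrKA (g (s + T * k./2.*2%:R / 2 ^+ m.+1))).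
  apply: (le_trans (ler_normD _ _)); apply: (le_trans (lerD h1 h2)).
  by rewrite e9'; lra.
have kE : k = k./2.*2 by rewrite -[LHS]odd_double_half (negbTE je).
have jm : (k./2 <= 2 ^ m)%N by move: kle; rewrite expnS; lia.
have := even _ jm; rewrite -kE => h; apply: (le_trans h).
by rewrite e9'; lra.
Qed.

(** The bound holds at dyadic points by summing the series, and extends to [t] by
    continuity. *)
Lemma tame_bound s T c g t : continuous g -> 0 <= c -> 0 < T -> tame s T c g ->
  s <= t -> t <= s + T -> `|g t - g s| <= c.
Proof.
move=> cg c0 T0 tg st tT; rewrite leNgt; apply/negP => cgt.
have e0 : 0 < `|g t - g s| - c by lra.
move: (cg t) => /cvgrPdist_lt /(_ _ e0) /nbhs_ballP[d /= d0 hd].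
(* the dyadic point just before [t] at a level with mesh less than [d] *)
have [m mTd] : exists m, T / 2 ^+ m < d.
  have := @cvg_geometric R T (1 / 2).
  rewrite ger0_norm; last by lra.
  move=> /(_ ltac:(lra)) /cvgrPdist_lt /(_ _ d0) [m _ hm].
  exists m; have := hm m (leqnn _).
  rewrite /= sub0r normrN /geometric/= ger0_norm; last first.
    by rewrite mulr_ge0 ?(ltW T0)// exprn_ge0//; lra.
  by rewrite expr_div_n expr1n mul1r.
have p2 : 0 < (2 ^+ m : R) by rewrite exprn_gt0.
pose z := (t - s) / T * 2 ^+ m.
have z0 : 0 <= z by rewrite mulr_ge0 ?divr_ge0 ?(ltW T0) ?(ltW p2)//; lra.
pose k := Num.truncn z.
have /andP[kz zk] : k%:R <= z < k.+1%:R by exact: truncn_itv.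
have zm : z <= 2 ^+ m.
  by rewrite /z ger_pMl// ler_pdivrMr// mul1r; lra.
have km : (k <= 2 ^ m)%N.
  by rewrite -(ler_nat R) natrX (le_trans kz).
have tE : t = s + T * z / 2 ^+ m by rewrite /z; field; rewrite !gt_eqF.
pose x := s + T * k%:R / 2 ^+ m.
have tx : t - x = T / 2 ^+ m * (z - k%:R).
  by rewrite [in LHS]tE /x; field; rewrite gt_eqF.
have Tm : 0 < T / 2 ^+ m by rewrite divr_gt0.
have dx : ball t d x.
  rewrite /ball/= tx ger0_norm; last by rewrite mulr_ge0 ?(ltW Tm)//; lra.
  apply: le_lt_trans mTd; rewrite ger_pMr//.
  by rewrite -natr1 in zk; lra.
have := hd _ dx; have := tame_dyadic c0 tg km; rewrite -/x => h1 h2.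
have : `|g t - g s| <= `|g t - g x| + `|g x - g s| by exact: ler_distD.
have p9 : 0 <= c * (9 / 10 : R) ^+ m.+1.
  by rewrite mulr_ge0// exprn_ge0//; lra.
by move: h1 h2; rewrite mulrBr mulr1; lra.
Qed.

(** The path or its opposite, according to the sign [e], reaches the level [h] at
    one of the times [h ^ 2 * 4 ^ (n * i)], [i <= n].  At such a time its
    standard deviation is [h * 2 ^ (n * i)], hence at least [h], and the ratio of
    successive times is so large that the past is negligible. *)
Definition overshoots e n h g := exists2 i, (i <= n)%N & h <= e * g ((h * 2 ^+ (n * i)) ^+ 2).

(** A quadratic exponent is what the overshoots require: to reach [scale_in n]
    with high probability, the path needs [n] times spaced by factors [4 ^ n],
    hence about the time [(scale_in n * 2 ^ (n ^ 2)) ^ 2]. *)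
Definition scale_in (n : nat) : R := 2 ^- (8 * n ^ 2).
Definition scale_out (n : nat) : R := 4 ^+ n.
(** Chosen so that the last sampling time, [(overshoot_level n * 2 ^ (n ^ 2)) ^ 2],
    is exactly [scale_in n.+1]. *)
Definition overshoot_level (n : nat) : R := 2 ^- (4 * n.+1 ^ 2 + n ^ 2).

Lemma scale_in_gt0 n : 0 < scale_in n.
Proof. by rewrite invr_gt0 exprn_gt0. Qed.

Lemma scale_out_gt0 n : 0 < scale_out n.
Proof. by rewrite exprn_gt0. Qed.

Lemma overshoot_level_gt0 n : 0 < overshoot_level n.
Proof. by rewrite invr_gt0 exprn_gt0. Qed.

Lemma scale_in_level n : (4 <= n)%N -> scale_in n <= overshoot_level n.
Proof.
move=> n4; rewrite lef_pV2 ?posrE ?exprn_gt0// ler_weXn2l ?ler1n//.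
by nia.
Qed.

Lemma overshoot_time_le n i : (i <= n)%N ->
  (overshoot_level n * 2 ^+ (n * i)) ^+ 2 <= scale_in n.+1.
Proof.
move=> ile.
have -> : scale_in n.+1 = (overshoot_level n * 2 ^+ (n * n)) ^+ 2.
  rewrite /scale_in /overshoot_level -!exprVn.
  have -> : (4 * n.+1 ^ 2 + n ^ 2 = 4 * n.+1 ^ 2 + n * n)%N by [].
  rewrite exprD -mulrA -exprMn mulVf// expr1n mulr1 -exprM; congr (_ ^+ _); lia.
have l0 := overshoot_level_gt0 n.
rewrite ler_sqr ?nnegrE ?mulr_ge0 ?exprn_ge0// ?(ltW l0)//.
by rewrite ler_pM2l// ler_weXn2l ?ler1n// leq_mul2l ile orbT.
Qed.

Definition half_spreads n g :=
  [/\ tame 0 (scale_out n.+1) (scale_out n) g,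
      overshoots 1 n (overshoot_level n) g
    & overshoots (-1) n (overshoot_level n) g].

Lemma half_spreads_image n g : continuous g -> g 0 = 0 -> (4 <= n)%N ->
  half_spreads n g ->
  (forall t, 0 <= t -> t <= scale_out n.+1 -> `|g t| <= scale_out n) /\
  `[- scale_in n, scale_in n] `<=` g @` `[0, scale_in n.+1].
Proof.
move=> cg g0 n4 [tg [i ile gi] [j jle gj]]; split=> [t t0 tM|y].
  have := tame_bound cg (ltW (scale_out_gt0 n)) (scale_out_gt0 n.+1) tg t0.
  by rewrite add0r g0 subr0; exact.
rewrite /= in_itv/= => /andP[y1 y2].
have [c [d [_ e]]] := image_segment cg (ltW (scale_in_gt0 n.+1)).
have hl := scale_in_level n4.
have gin k : (k <= n)%N -> (g @` `[0, scale_in n.+1])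
    (g ((overshoot_level n * 2 ^+ (n * k)) ^+ 2)).
  move=> kn; eexists; last reflexivity.
  by rewrite /= in_itv/= sqr_ge0 overshoot_time_le.
move: (gin _ ile) (gin _ jle) gi gj.
set u := g _; set v := g (_ ^+ 2).
have E z : (g @` `[0, scale_in n.+1]) z <-> c <= z <= d.
  by rewrite e /= in_itv.
by move=> /E ? /E ? ? ?; apply/E; lra.
Qed.

(** The three increments are [3 a], [- 6 a] and [3 a] up to a slack of
    [3 / 10 * a]: the path comes close to [3 a] and [- 3 a] and is back near 0 at
    time [d].  Afterwards it moves by at most [a] until time [m], so that it stays
    between the extreme values already attained. *)
Definition collapse_right d m a g :=
  [/\ 3 * a <= g (d / 3) - g 0 <= 33 / 10 * a,
      - (63 / 10) * a <= g (2 * d / 3) - g (d / 3) <= - 6 * a,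
      3 * a <= g d - g (2 * d / 3) <= 33 / 10 * a
    & tame d (m - d) a g].

Definition path_spreads n g := half_spreads n g /\ half_spreads n (g \o -%R).

Lemma path_spreads_spreads n g : continuous g -> g 0 = 0 -> (4 <= n)%N ->
  path_spreads n g ->
  spreads g (scale_in n.+1) (scale_out n.+1) (scale_in n) (scale_out n).
Proof.
move=> cg g0 n4 [hr hl].
have cgN : continuous (g \o -%R).
  by move=> x; apply: continuous_comp; [exact: opp_continuous|exact: cg].
have gN0 : (g \o -%R) 0 = 0 by rewrite /= oppr0.
have [br ir] := half_spreads_image cg g0 n4 hr.
have [bl il] := half_spreads_image cgN gN0 n4 hl.
split=> //.
  move=> _ [t /= + <-]; rewrite !in_itv/= -!ler_norml => tM.
  have [t0|t0] := leP 0 t; first by apply: br; rewrite // -(ger0_norm t0).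
  have := bl (- t); rewrite /= opprK; apply; first lra.
  by rewrite -(ltr0_norm t0).
move=> y /il[t /= + <-]; rewrite in_itv/= => /andP[t0 t1].
by exists (- t); rewrite //= in_itv/=; lra.
Qed.

(** The zigzag on the right of 0 attains [2 * a] and [- 2 * a], so on the left it is
    enough to stay between these values. *)
Definition path_collapses d m a g :=
  collapse_right d m a g /\ tame 0 m (2 * a) (g \o -%R).

Lemma path_collapses_image d m a g : continuous g -> g 0 = 0 ->
  0 < a -> 0 < d -> d < m -> path_collapses d m a g ->
  g @` `[- m, m] `<=` g @` `[- d, d].
Proof.
move=> cg g0 a0 d0 dm [[g1 g2 g3 tr] tl] _ [t + <-]; rewrite /= in_itv/= => tm.
have cgN : continuous (g \o -%R).
  by move=> x; apply: continuous_comp; [exact: opp_continuous|exact: cg].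
have [td|td] := lerP `|t| d.
  by exists t => //; rewrite /= in_itv/= -ler_norml.
have gt : `|g t| <= 2 * a.
  have [t0|t0] := lerP 0 t.
    have := tame_bound (t := t) cg (ltW a0) _ tr.
    rewrite (ger0_norm t0) in td; rewrite subr_gt0 => /(_ dm (ltW td)).
    by rewrite !ler_norml; lra.
  have a20 : 0 <= 2 * a by lra.
  have := tame_bound (t := - t) cgN a20 (lt_trans d0 dm) tl.
  by rewrite /= opprK oppr0 g0 subr0 => h; apply: h; lra.
have [c [c' [_ e]]] : exists c c', c <= c' /\ g @` `[- d, d] = `[c, c']%classic.
  by apply: image_segment => //; lra.
have gin x : 0 <= x -> x <= d -> (g @` `[- d, d]) (g x).
  by move=> x0 xd; exists x => //; rewrite /= in_itv/=; lra.
have := gin (d / 3); have := gin (2 * d / 3).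
have E z : (g @` `[- d, d]) z <-> c <= z <= c' by rewrite e /= in_itv.
move=> h2 h1; have /E {}h1 := h1 ltac:(lra) ltac:(lra).
have /E {}h2 := h2 ltac:(lra) ltac:(lra).
by apply/E; move: gt; rewrite ler_norml; lra.
Qed.

End path_events.

(** * Measurability of the path conditions *)

Definition up_move (R : realType) (a : R) : set R :=
  `[3 * a, 33 / 10 * a]%classic.

Definition down_move (R : realType) (a : R) : set R :=
  `[- (63 / 10) * a, - 6 * a]%classic.

Lemma measurable_up_move (R : realType) (a : R) : measurable (up_move a).
Proof. exact: measurable_itv. Qed.

Lemma measurable_down_move (R : realType) (a : R) : measurable (down_move a).
Proof. exact: measurable_itv. Qed.

Section measurable_path_events.
Context (R : realType) (d : measure_display) (S : measurableType d).
Variable W : S -> R -> R.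
Hypothesis mW : forall t, 0 <= t -> measurable_fun setT (W ^~ t).

Lemma measurable_value_preimage t (Y : set R) : 0 <= t -> measurable Y ->
  measurable [set w | Y (W w t)].
Proof. by move=> t0 mY; have := mW t0 measurableT mY; rewrite setTI. Qed.

Lemma measurable_increment_preimage s t (Y : set R) : 0 <= s -> 0 <= t ->
  measurable Y -> measurable [set w | Y (W w t - W w s)].
Proof.
move=> s0 t0 mY.
have mB := @measurable_funB _ _ _ setT _ _ (mW t0) (mW s0).
by have := mB measurableT _ mY; rewrite setTI.
Qed.

Lemma measurable_absr_le (x : R) : measurable [set z : R | `|z| <= x].
Proof.
have -> : [set z : R | `|z| <= x] = `[- x, x]%classic.
  by apply/seteqP; split=> z /=; rewrite in_itv/= ler_norml.
exact: measurable_itv.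
Qed.

Lemma measurable_tame s T c : 0 <= s -> 0 <= T ->
  measurable [set w | tame s T c (W w)].
Proof.
move=> s0 T0.
have -> : [set w | tame s T c (W w)] = \bigcap_m \bigcap_k
    [set w | (k < 2 ^ m)%N ->
      `|W w (s + T * k.+1%:R / 2 ^+ m) - W w (s + T * k%:R / 2 ^+ m)|
        <= c / 10 * (9 / 10) ^+ m].
  apply/seteqP; split=> [w tw m _ k _|w h m k]; first exact: tw.
  exact: (h m I k I).
apply: bigcapT_measurable => m; apply: bigcapT_measurable => k.
have [km|km] := ltnP k (2 ^ m); last first.
  by rewrite (_ : [set _ | _] = setT)//; apply/seteqP; split.
have nonneg j : 0 <= s + T * j%:R / 2 ^+ m.
  by rewrite addr_ge0// divr_ge0 ?exprn_ge0// mulr_ge0.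
have := @measurable_increment_preimage _ _ _ (nonneg k) (nonneg k.+1)
  (measurable_absr_le (c / 10 * (9 / 10) ^+ m)).
by congr measurable; apply/seteqP; split=> w /=; [move=> h _|apply].
Qed.

Lemma measurable_overshoots e n h : measurable [set w | overshoots e n h (W w)].
Proof.
have -> : [set w | overshoots e n h (W w)] = \bigcup_(i in [set i | (i <= n)%N])
    [set w | [set z : R | h <= e * z] (W w ((h * 2 ^+ (n * i)) ^+ 2))].
  by apply/seteqP; split=> w /= [i ? ?]; exists i.
apply: bigcup_measurable => i _.
apply: (@measurable_value_preimage _ [set z : R | h <= e * z]).
  exact: sqr_ge0.
exact: measurable_scaled_ge.
Qed.

Lemma measurable_half_spreads n : measurable [set w | half_spreads n (W w)].
Proof.
have -> : [set w | half_spreads n (W w)] =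
    [set w | tame 0 (scale_out R n.+1) (scale_out R n) (W w)]
    `&` ([set w | overshoots 1 n (overshoot_level R n) (W w)]
    `&` [set w | overshoots (-1) n (overshoot_level R n) (W w)]).
  by apply/seteqP; split=> [w [? ? ?]|w [? [? ?]]]; split.
apply: measurableI; first by apply: measurable_tame => //; exact/ltW/scale_out_gt0.
by apply: measurableI; exact: measurable_overshoots.
Qed.

(** The part of [collapse_right] that involves the path up to time [r] only. *)
Definition zigzag (a r : R) (w : S) :=
  [/\ 3 * a <= W w (r / 3) - W w 0 <= 33 / 10 * a,
      - (63 / 10) * a <= W w (2 * r / 3) - W w (r / 3) <= - 6 * a
    & 3 * a <= W w r - W w (2 * r / 3) <= 33 / 10 * a].

Lemma zigzagE a r : [set w | zigzag a r w] =
  [set w | up_move a (W w (r / 3) - W w 0)]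
  `&` ([set w | down_move a (W w (2 * r / 3) - W w (r / 3))]
  `&` [set w | up_move a (W w r - W w (2 * r / 3))]).
Proof.
by apply/seteqP; split=> w /=; rewrite /zigzag /up_move /down_move/= !in_itv/= => -[? []].
Qed.

Lemma measurable_zigzag a r : 0 <= r -> measurable [set w | zigzag a r w].
Proof.
move=> d0; rewrite zigzagE.
have mu := measurable_up_move a; have md := measurable_down_move a.
apply: measurableI; first by apply: (measurable_increment_preimage _ _ mu); lra.
apply: measurableI; first by apply: (measurable_increment_preimage _ _ md); lra.
by apply: (measurable_increment_preimage _ _ mu); lra.
Qed.

Lemma measurable_collapse_right r m a : 0 <= r -> r <= m ->
  measurable [set w | collapse_right r m a (W w)].
Proof.
move=> d0 dm.
have -> : [set w | collapse_right r m a (W w)] =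
    [set w | zigzag a r w] `&` [set w | tame r (m - r) a (W w)].
  by apply/seteqP; split=> w [] => [? ? ? ?|[? ? ?] ?]; split.
apply: measurableI; first exact: measurable_zigzag.
by apply: measurable_tame => //; lra.
Qed.

End measurable_path_events.

(** * Oscillation of a Brownian path *)

Section brownian_estimates.
Context (R : realType) (d : measure_display) (Omega : measurableType d).
Variables (P : probability Omega R) (W : Omega -> R -> R).
Hypothesis hW : brownian_motion P W.

Let mW t : 0 <= t -> measurable_fun setT (W ^~ t).
Proof. exact: bm_measurable hW t. Qed.

Lemma increment_law s t (Y : set R) : 0 <= s -> s < t -> measurable Y ->
  P [set w | Y (W w t - W w s)] = normal_prob 0 (Num.sqrt (t - s)) Y.
Proof. by move=> s0 st mY; exact: (bm_normal_increments hW s0 st mY). Qed.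

(** The normal laws turn the independence of the increments into an explicit
    product. *)
Lemma increments_prod k (t : nat -> R) (Y : nat -> set R) (s : seq 'I_k) :
  0 <= t 0%N -> (forall i, (i < k)%N -> t i < t i.+1) -> uniq s ->
  (forall i, measurable (Y i)) ->
  P (\bigcap_(i in [set` s]) [set w | Y i (W w (t i.+1) - W w (t i))])
  = (\prod_(i <- s) normal_prob 0 (Num.sqrt (t i.+1 - t i)) (Y i))%E.
Proof.
move=> t0 tk us mY.
have nat_ge0 i : (i <= k)%N -> 0 <= t i.
  elim: i => [//|i IH] ik; apply: le_trans (IH (ltnW ik)) _.
  exact/ltW/tk.
rewrite (bm_independent_increments hW t0 tk us); last first.
  by move=> i _; exists (Y i) => //; rewrite setTI.
apply: eq_bigr => i _; apply: increment_law => //; last exact: tk.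
by apply: nat_ge0; exact: ltnW.
Qed.

Lemma increment_tail s t u : 0 <= s -> s < t -> 0 < u ->
  (P [set w | (u <= `|W w t - W w s|)%R] <= (64 * (t - s) ^+ 2 / u ^+ 4)%:E)%E.
Proof.
move=> s0 st u0; have ts : 0 < t - s by rewrite subr_gt0.
rewrite (increment_law s0 st (measurable_absr_ge u)); apply: (le_trans (normal_prob_tail _ u0)).
  by rewrite sqrtr_gt0.
rewrite lee_fin expr_div_n mulrA.
have -> : Num.sqrt (t - s) ^+ 4 = (Num.sqrt (t - s) ^+ 2) ^+ 2 by rewrite -exprM.
by rewrite sqr_sqrtr// ltW.
Qed.

Lemma geometric_eseries_le (f : nat -> \bar R) (x z : R) : 0 <= x -> 0 < z < 1 ->
  (forall n, 0 <= f n)%E -> (forall n, f n <= (x * z ^+ n)%:E)%E ->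
  (\sum_(n <oo) f n <= (x / (1 - z))%:E)%E.
Proof.
move=> x0 /andP[z0 z1] f0 fle.
apply: lime_le; first by apply: is_cvg_nneseries.
apply: nearW => n; apply: (@le_trans _ _ (\sum_(0 <= i < n) (x * z ^+ i)%:E)%E).
  by apply: lee_sum => i _; exact: fle.
rewrite sumEFin lee_fin.
have := @geometric_le_lim R n x z x0 z0; rewrite ger0_norm ?(ltW z0)//.
by move=> /(_ z1).
Qed.

Definition tame_cst : R := 32 * 10 ^+ 5.

(** A union bound over all dyadic increments, each with its quartic tail.  The
    event [V] is carried along because it is only assumed independent of each
    single increment: the factor [P V] must enter term by term. *)
Lemma not_tame_prob (s T c : R) (V : set Omega) : 0 <= s -> 0 < T -> 0 < c ->
  measurable V ->
  (forall (s' t' : R) (Y : set R), s <= s' -> s' < t' -> measurable Y ->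
    P (V `&` [set w | Y (W w t' - W w s')])
    = (P V * P [set w | Y (W w t' - W w s')%R])%E) ->
  (P (V `&` ~` [set w | tame s T c (W w)])
    <= P V * (tame_cst * T ^+ 2 / c ^+ 4)%:E)%E.
Proof.
move=> s0 T0 c0 mV indepV.
pose time m k := s + T * k%:R / 2 ^+ m.
pose lev m : R := c / 10 * (9 / 10) ^+ m.
have lev0 m : 0 < lev m by rewrite mulr_gt0 ?exprn_gt0//; lra.
have p2 m : 0 < (2 ^+ m : R) by rewrite exprn_gt0.
have time_ge m k : s <= time m k.
  by rewrite lerDl divr_ge0 ?(ltW (p2 m))// mulr_ge0// ltW.
have timeB m k : time m k.+1 - time m k = T / 2 ^+ m.
  by rewrite /time -natr1; field; rewrite gt_eqF.
have time_lt m k : time m k < time m k.+1.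
  by rewrite -subr_gt0 timeB divr_gt0.
pose A m k := V `&`
  [set w | [set x : R | lev m <= `|x|] (W w (time m k.+1) - W w (time m k))].
have mA m k : measurable (A m k).
  apply: measurableI => //.
  apply: (measurable_increment_preimage mW _ _ (measurable_absr_ge (lev m))).
    exact: le_trans (time_ge _ _).
  exact: le_trans (time_ge _ _).
pose v := fine (P V).
have vE : P V = v%:E by rewrite /v fineK// fin_num_measure.
have v0 : 0 <= v by rewrite fine_ge0.
have PA m k : (P (A m k) <= (v * (64 * (T / 2 ^+ m) ^+ 2 / lev m ^+ 4))%:E)%E.
  rewrite /A (indepV _ _ [set x : R | lev m <= `|x|])//; last exact: measurable_absr_ge.
  rewrite vE EFinM; apply: lee_wpmul2l; first by rewrite lee_fin.
  rewrite -(timeB m k); apply: increment_tail => //.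
  exact: le_trans (time_ge _ _).
pose B m := \big[setU/set0]_(k < 2 ^ m) A m k.
have mB m : measurable (B m) by apply: bigsetU_measurable.
have PB m : (P (B m) <= (v * (64 * 10 ^+ 4 * T ^+ 2 / c ^+ 4) * (4 / 5) ^+ m)%:E)%E.
  apply: (le_trans (Boole_inequality _ _)) => //.
  apply: (@le_trans _ _ (\sum_(k < 2 ^ m)
      (v * (64 * (T / 2 ^+ m) ^+ 2 / lev m ^+ 4))%:E)%E).
    by apply: lee_sum => k _; exact: PA.
  rewrite sumEFin lee_fin sumr_const card_ord -[leLHS]mulr_natl natrX.
  have x0 : 0 < (9 / 10 : R) ^+ m by rewrite exprn_gt0//; lra.
  have -> : 2%:R ^+ m * (v * (64 * (T / 2 ^+ m) ^+ 2 / lev m ^+ 4)) =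
    v * (64 * 10 ^+ 4 * T ^+ 2 / c ^+ 4) * (1 / (2 ^+ m * ((9 / 10) ^+ m) ^+ 4)).
    by rewrite /lev; field; rewrite !gt_eqF.
  apply: ler_wpM2l.
    rewrite mulr_ge0// divr_ge0 ?exprn_ge0 ?(ltW c0)//.
    by rewrite mulr_ge0// sqr_ge0.
  have -> : 1 / (2 ^+ m * ((9 / 10) ^+ m) ^+ 4)
      = (1 / (2 * (9 / 10) ^+ 4)) ^+ m :> R.
    by move: (9 / 10) => x; rewrite !div1r exprVn exprMn exprAC.
  by apply: lerXn2r; rewrite ?nnegrE; lra.
apply: (@le_trans _ _ (\sum_(m <oo) P (B m))%E).
  apply: measure_sigma_subadditive => //.
    apply: measurableI => //; apply: measurableC.
    by apply: measurable_tame => //; exact: ltW.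
  move=> w [Vw]; rewrite /= /tame => /existsNP[m /existsNP[k]].
  move=> /not_implyP[km] /negP; rewrite -ltNge => /ltW hw.
  by exists m => //; rewrite /B -bigcup_mkord; exists k.
apply: (le_trans (geometric_eseries_le _ _ _ PB)) => //.
- rewrite mulr_ge0// divr_ge0 ?exprn_ge0 ?(ltW c0)//.
  by rewrite mulr_ge0// sqr_ge0.
- by lra.
rewrite vE -EFinM lee_fin /tame_cst.
rewrite le_eqVlt; apply/orP; left; apply/eqP.
by field; rewrite gt_eqF.
Qed.

Definition overshoot_cst : R := normal_peak 1 * expR (- 6).

Lemma overshoot_cst_gt0 : 0 < overshoot_cst.
Proof. by rewrite mulr_gt0 ?expR_gt0// normal_peak_gt0. Qed.

(** The segment from [2 r] to [3 r] has length at least one standard deviation and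
    lies within [sqrt 12] standard deviations of 0. *)
Lemma normal_prob_overshoot (e s r : R) : e = 1 \/ e = - 1 ->
  0 < s -> s <= r -> 3 / 4 * r ^+ 2 <= s ^+ 2 ->
  (overshoot_cst%:E <= normal_prob 0 s [set z : R | (2 * r <= e * z)%R])%E.
Proof.
move=> e1 s0 sr rs; have r0 : 0 < r by exact: lt_le_trans sr.
have bound (x y : R) : y - x = r -> - (3 * r) <= x -> y <= 3 * r ->
    (overshoot_cst%:E <= normal_prob 0 s `[x, y])%E.
  move=> yx mx ym; have xy : x <= y by lra.
  apply: le_trans (normal_prob_itv_ge s0 xy mx ym).
  rewrite lee_fin /overshoot_cst yx; apply: ler_pM.
  - exact: normal_peak_ge0.
  - exact: expR_ge0.
  - rewrite ler_peMr ?normal_peak_ge0// ler_pdivlMr// mul1r//.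
  - rewrite ler_expR expr_div_n.
    have s2 : 0 < s ^+ 2 by rewrite exprn_gt0.
    have : (3 * r) ^+ 2 / s ^+ 2 <= 12 by rewrite ler_pdivrMr//; lra.
    by lra.
have m := measurable_scaled_ge e (2 * r).
case: e1 m => -> m.
  apply: (le_trans (bound (2 * r) (3 * r) _ _ _)); [lra..|].
  apply: le_measure; rewrite ?inE//.
  by move=> z /=; rewrite in_itv/=; lra.
apply: (le_trans (bound (- (3 * r)) (- (2 * r)) _ _ _)); [lra..|].
apply: le_measure; rewrite ?inE//.
by move=> z /=; rewrite in_itv/=; lra.
Qed.

Lemma prode_le_expn (I : Type) (s : seq I) (f : I -> \bar R) (x : R) : 0 <= x ->
  (forall i, 0 <= f i)%E -> (forall i, f i <= x%:E)%E ->
  (\prod_(i <- s) f i <= (x ^+ size s)%:E)%E.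
Proof.
move=> x0 f0 fx; elim: s => [|i s IH]; first by rewrite big_nil.
rewrite big_cons /= exprS EFinM; apply: lee_pmul => //.
by apply: prode_ge0 => j _.
Qed.

(** Write [r i = h * 2 ^ (n * i)], the standard deviation at time [r i ^ 2].  If the
    level [h] is never reached, then either at some time the path is farther
    from 0 than [r i.+1], which is [2 ^ n] standard deviations, or all the
    increments stay below [2 * r i.+1].  The increments are independent and each
    of them exceeds that value with probability at least [overshoot_cst]. *)
Lemma not_overshoots_prob (e h : R) n : e = 1 \/ e = - 1 -> (0 < n)%N -> 0 < h ->
  (P (~` [set w | overshoots e n h (W w)])
    <= (64 * n%:R / 16 ^+ n + (1 - overshoot_cst) ^+ n)%:E)%E.
Proof.
move=> e1 n0 h0; pose r i := h * 2 ^+ (n * i); pose t i := r i ^+ 2.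
have r0 i : 0 < r i by rewrite mulr_gt0// exprn_gt0.
have rS i : r i.+1 = r i * 2 ^+ n by rewrite /r mulnS addnC exprD mulrA.
have n2 : 2 <= 2 ^+ n :> R by rewrite -[leLHS]expr1 ler_weXn2l// ler1n.
have tlt i : t i < t i.+1.
  by rewrite /t ltr_sqr ?nnegrE ?(ltW (r0 _))// rS; have := r0 i; nra.
have t_gt0 i : 0 < t i by rewrite exprn_gt0.
have B0 w : W w 0 = 0 by exact: bm_start hW w.
pose A i := [set w | [set x : R | r i.+1 <= `|x|] (W w (t i) - W w 0)].
pose Y i := ~` [set z : R | 2 * r i.+1 <= e * z].
have mY i : measurable (Y i).
  exact: (measurableC (measurable_scaled_ge e (2 * r i.+1))).
pose C := \bigcap_(i in [set` enum 'I_n])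
  [set w | Y i (W w (t i.+1) - W w (t i))].
have mA i : measurable (A i).
  apply: (measurable_increment_preimage mW _ _ (measurable_absr_ge (r i.+1))) => //.
  exact: ltW.
have mC : measurable C.
  apply: fin_bigcap_measurable => // i _.
  by apply: (measurable_increment_preimage mW _ _ (mY i)); exact: ltW.
have mU : measurable (\big[setU/set0]_(i < n) A i) by apply: bigsetU_measurable.
have sub : ~` [set w | overshoots e n h (W w)] `<=`
    (\big[setU/set0]_(i < n) A i) `|` C.
  move=> w nov; apply: contrapT => /not_orP[nA nC].
  apply: nC => i _ /= big.
  have nAi : ~ A i w.
    by move=> Aw; apply: nA; rewrite -bigcup_mkord; exists (val i) => /=.
  have wlt : e * W w (t i.+1) < h.
    rewrite ltNge; apply/negP => hw; apply: nov; exists i.+1 => //.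
  have : h <= r i.+1.
    by rewrite /r ler_peMr ?(ltW h0)// exprn_ege1// ler1n.
  move: nAi big; rewrite /A /= B0 subr0 => /negP; rewrite -ltNge ltr_norml.
  by case: e1 wlt => ->; lra.
have PA i : (P (A i) <= (64 / 16 ^+ n)%:E)%E.
  rewrite /A; apply: (le_trans (increment_tail _ _ (r0 i.+1))) => //.
  rewrite lee_fin subr0 le_eqVlt; apply/orP; left; apply/eqP.
  have -> : 16 ^+ n = (2 ^+ n) ^+ 4 :> R.
    by rewrite -exprM mulnC exprM; congr (_ ^+ _); rewrite -natrX.
  rewrite rS /t; field.
  by rewrite !gt_eqF ?exprn_gt0.
apply: (le_trans (le_measure _ _ _ sub)); rewrite ?inE.
- by apply: measurableC; exact: measurable_overshoots.
- exact: measurableU.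
apply: (le_trans (measureU2 _ mU mC)); rewrite EFinD; apply: leeD.
  apply: (le_trans (Boole_inequality _ _)) => //.
  apply: (@le_trans _ _ (\sum_(i < n) (64 / 16 ^+ n)%:E)%E).
    by apply: lee_sum => i _; exact: PA.
  rewrite sumEFin lee_fin sumr_const card_ord -[leLHS]mulr_natl.
  by rewrite mulrA (mulrC n%:R).
have c0 := overshoot_cst_gt0.
have PY i : (normal_prob 0 (Num.sqrt (t i.+1 - t i)) (Y i)
    <= (1 - overshoot_cst)%:E)%E.
  have ti : 0 < t i.+1 - t i by rewrite subr_gt0.
  have n2' : 4 <= (2 ^+ n) ^+ 2 :> R.
    by nra.
  rewrite /Y -/(setC _).
  have mo := measurable_scaled_ge e (2 * r i.+1).
  have -> : normal_prob 0 (Num.sqrt (t i.+1 - t i)) (~` [set z : R | 2 * r i.+1 <= e * z])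
     = (1 - normal_prob 0 (Num.sqrt (t i.+1 - t i)) [set z : R | (2 * r i.+1 <= e * z)%R])%E.
    exact: probability_setC.
  rewrite EFinB; apply: leeB => //; apply: normal_prob_overshoot => //.
  - by rewrite sqrtr_gt0.
  - have -> : r i.+1 = Num.sqrt (t i.+1).
      by rewrite sqrtr_sqr (ger0_norm (ltW (r0 _))).
    by rewrite ler_wsqrtr// gerBl ltW.
  - rewrite sqr_sqrtr ?(ltW ti)// /t rS.
    move: n2'; rewrite -subr_ge0 => /(mulr_ge0 (ltW (t_gt0 i))).
    by rewrite /t; move: (r i) (2 ^+ n) => x y; lra.
have x0 : 0 <= 1 - overshoot_cst.
  rewrite -lee_fin; apply: le_trans (PY 0%N); exact: measure_ge0.
have PC := @increments_prod n t Y (enum 'I_n) (ltW (t_gt0 0%N))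
  (fun i _ => tlt i) (enum_uniq _) mY.
rewrite -[leLHS]/(P C) PC.
have := @prode_le_expn _ (enum 'I_n)
  (fun i => normal_prob 0 (Num.sqrt (t i.+1 - t i)) (Y i)) _ x0.
rewrite size_enum_ord.
by apply => i; [exact: measure_ge0|exact: PY].
Qed.

End brownian_estimates.

(** * Collapsing Brownian paths *)

Section zigzag_estimates.
Context (R : realType) (d : measure_display) (Omega : measurableType d).
Variables (P : probability Omega R) (W : Omega -> R -> R).
Hypothesis hW : brownian_motion P W.

Let mW t : 0 <= t -> measurable_fun setT (W ^~ t).
Proof. exact: bm_measurable hW t. Qed.

Definition zigzag_cst (a r : R) : \bar R :=
  (normal_prob 0 (Num.sqrt (r / 3)%R) (up_move a)
   * (normal_prob 0 (Num.sqrt (r / 3)%R) (down_move a)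
   * normal_prob 0 (Num.sqrt (r / 3)%R) (up_move a)))%E.

Lemma zigzag_cst_gt0 (a r : R) : 0 < a -> 0 < r -> (0 < zigzag_cst a r)%E.
Proof.
move=> a0 r0.
have pos (x y : R) : x < y -> - (7 * a) <= x -> y <= 7 * a ->
    (0 < normal_prob 0 (Num.sqrt (r / 3)%R) `[x, y]%classic)%E.
  move=> xy mx ym; have s0 : 0 < Num.sqrt (r / 3) by rewrite sqrtr_gt0; lra.
  apply: lt_le_trans (normal_prob_itv_ge s0 (ltW xy) mx ym).
  rewrite lte_fin !mulr_gt0 ?expR_gt0 ?normal_peak_gt0 ?invr_gt0//.
  by rewrite subr_gt0.
by rewrite /zigzag_cst !mule_gt0//; apply: pos; lra.
Qed.

(** If [r < s'], there is one more increment between times [r] and [s'], on which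
    no condition is imposed. *)
Lemma zigzag_increment_prob (a r : R) s' t' (Y : set R) : 0 < r -> r <= s' ->
  s' < t' -> measurable Y ->
  P ([set w | zigzag W a r w] `&` [set w | Y (W w t' - W w s')])
  = (zigzag_cst a r * normal_prob 0 (Num.sqrt (t' - s')) Y)%E.
Proof.
move=> r0 rs st mY.
have d1 : r / 3 - 0 = r / 3 by ring.
have d2 : 2 * r / 3 - r / 3 = r / 3 by field.
have d3 : r - 2 * r / 3 = r / 3 by field.
have [N NE] : exists N : R -> set R -> \bar R,
    forall s Y, normal_prob 0 (Num.sqrt s) Y = N s Y.
  by exists (fun s Y => normal_prob 0 (Num.sqrt s) Y).
rewrite /zigzag_cst !NE.
have NT s : N s setT = 1%E by rewrite -NE probability_setT.
pose Y1 := up_move a.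
pose Y2 := down_move a.
have [rs'|rs'] := eqVneq s' r.
  subst s'; pose t := nth 0 [:: 0; r / 3; 2 * r / 3; r; t'].
  pose Z := nth setT [:: Y1; Y2; Y1; Y].
  have mZ i : measurable (Z i).
    by move: i => [|[|[|[|i]]]] //=; rewrite /Z /= ?nth_nil//;
      [exact: measurable_up_move|exact: measurable_down_move|exact: measurable_up_move].
  have tlt i : (i < 4)%N -> t i < t i.+1.
    by move: i => [|[|[|[|i]]]] //= _; rewrite /t /=; lra.
  have := @increments_prod _ _ _ _ _ hW 4 t Z (enum 'I_4) (lexx _) tlt (enum_uniq _) mZ.
  under eq_bigr do rewrite NE.
  rewrite big_enum /= !big_ord_recl big_ord0 /= /bump /= !add1n /t /Z /=.
  rewrite d1 d2 d3 mule1 !muleA => <-; congr (P _).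
  rewrite zigzagE; apply/seteqP; split=> [w [[z1 [z2 z3]] z4]|w h].
    by case=> [[|[|[|[|i]]]] //= ?] _.
  have hh i (ik : (i < 4)%N) := h (Ordinal ik) (mem_enum _ _).
  by move: (hh 0%N isT) (hh 1%N isT) (hh 2%N isT) (hh 3%N isT).
have {}rs' : r < s' by rewrite lt_neqAle eq_sym rs'.
pose t := nth 0 [:: 0; r / 3; 2 * r / 3; r; s'; t'].
pose Z := nth setT [:: Y1; Y2; Y1; setT; Y].
have mZ i : measurable (Z i).
  by move: i => [|[|[|[|[|i]]]]] //=; rewrite /Z /= ?nth_nil//;
    [exact: measurable_up_move|exact: measurable_down_move|exact: measurable_up_move].
have tlt i : (i < 5)%N -> t i < t i.+1.
  by move: i => [|[|[|[|[|i]]]]] //= _; rewrite /t /=; lra.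
have := @increments_prod _ _ _ _ _ hW 5 t Z (enum 'I_5) (lexx _) tlt (enum_uniq _) mZ.
under eq_bigr do rewrite NE.
rewrite big_enum /= !big_ord_recl big_ord0 /= /bump /= !add1n /t /Z /=.
rewrite d1 d2 d3 NT mule1 mul1e !muleA => <-; congr (P _).
rewrite zigzagE; apply/seteqP; split=> [w [[z1 [z2 z3]] z4]|w h].
  by case=> [[|[|[|[|[|i]]]]] //= ?] _.
have hh i (ik : (i < 5)%N) := h (Ordinal ik) (mem_enum _ _).
by move: (hh 0%N isT) (hh 1%N isT) (hh 2%N isT) (hh 4%N isT).
Qed.

Lemma zigzag_prob (a r : R) : 0 < r -> P [set w | zigzag W a r w] = zigzag_cst a r.
Proof.
move=> r0; have rr : r < r + 1 by rewrite ltrDl.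
have := @zigzag_increment_prob a r r (r + 1) setT r0 (lexx _) rr measurableT.
rewrite probability_setT mule1 => <-; congr (P _).
by apply/seteqP; split=> w // [].
Qed.

(** Conditionally on the zigzag, the path after time [r] stays tame with
    probability at least 1/2 as soon as [a] is large compared to [sqrt m]. *)
Lemma collapse_right_prob (a r m : R) : 0 < a -> 0 < r -> r < m ->
  tame_cst R * m ^+ 2 / a ^+ 4 <= 1 / 2 ->
  (zigzag_cst a r * (1 / 2)%:E <= P [set w | collapse_right r m a (W w)])%E.
Proof.
move=> a0 r0 rm am; have r0' := ltW r0; have mr : 0 < m - r by rewrite subr_gt0.
have mz := measurable_zigzag mW a r0'.
have mt : measurable [set w | tame r (m - r) a (W w)].
  by apply: measurable_tame => //; exact: ltW.
have cE : [set w | collapse_right r m a (W w)]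
    = [set w | zigzag W a r w] `&` [set w | tame r (m - r) a (W w)].
  by apply/seteqP; split=> w [] => [? ? ? ?|[? ? ?] ?]; split.
have bad : (P ([set w | zigzag W a r w] `&` ~` [set w | tame r (m - r) a (W w)])
    <= zigzag_cst a r * (1 / 2)%:E)%E.
  apply: (le_trans (not_tame_prob hW r0' mr a0 mz _)).
    move=> s' t' Y rs st mY; rewrite zigzag_increment_prob// zigzag_prob//.
    by rewrite (increment_law hW)// (le_trans r0').
  rewrite zigzag_prob//; apply: lee_wpmul2l; first exact/ltW/zigzag_cst_gt0.
  rewrite lee_fin; apply: le_trans am.
  rewrite ler_pM2r ?invr_gt0 ?exprn_gt0// ler_pM2l; last first.
    by rewrite /tame_cst; rewrite mulr_gt0// exprn_gt0.
  by rewrite ler_sqr ?nnegrE; lra.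
have zfin : zigzag_cst a r \is a fin_num.
  by rewrite -zigzag_prob// fin_num_measure.
have split_z := measureDI P mz mt.
have : (zigzag_cst a r = P [set w | collapse_right r m a (W w)] +
   P ([set w | zigzag W a r w] `\` [set w | tame r (m - r) a (W w)]))%E.
  by rewrite -zigzag_prob// [LHS]split_z cE addeC.
rewrite setDE => zsum.
have hz : (zigzag_cst a r = zigzag_cst a r * (1 / 2)%:E + zigzag_cst a r * (1 / 2)%:E)%E.
  move: zfin; case: (zigzag_cst a r) => // x _.
  by rewrite -!EFinM -EFinD; congr (_%:E); lra.
have hfin : (zigzag_cst a r * (1 / 2)%:E \is a fin_num)%E by rewrite fin_numM.
rewrite -(leeD2rE _ _ hfin) -hz zsum; apply: leeD2l.
by rewrite -zsum.
Qed.

Lemma not_tame_prob_start (c T : R) : 0 < c -> 0 < T ->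
  (P (~` [set w | tame 0 T c (W w)]) <= (tame_cst R * T ^+ 2 / c ^+ 4)%:E)%E.
Proof.
move=> c0 T0.
have := @not_tame_prob _ _ _ _ _ hW 0 T c setT (lexx _) T0 c0 measurableT.
rewrite setTI probability_setT mul1e; apply=> s t Y _ _ _.
by rewrite setTI mul1e.
Qed.

Lemma tame_prob_half (c T : R) : 0 < c -> 0 < T ->
  tame_cst R * T ^+ 2 / c ^+ 4 <= 1 / 2 ->
  ((1 / 2)%:E <= P [set w | tame 0 T c (W w)])%E.
Proof.
move=> c0 T0 cT; have mt : measurable [set w | tame 0 T c (W w)].
  by apply: measurable_tame => //; exact: ltW.
rewrite -[X in P X]setCK probability_setC; last exact: measurableC.
apply: (@le_trans _ _ (1 - (1 / 2)%:E)%E).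
  by rewrite -EFinB lee_fin; lra.
apply: leeB => //; apply: (le_trans (not_tame_prob_start c0 T0)).
by rewrite lee_fin.
Qed.

(** One upper bound, and two overshoots with opposite signs. *)
Lemma not_half_spreads_prob n : (0 < n)%N ->
  (P (~` [set w | half_spreads n (W w)]) <=
   (tame_cst R * scale_out R n.+1 ^+ 2 / scale_out R n ^+ 4
    + 2 * (64 * n%:R / 16 ^+ n + (1 - overshoot_cst R) ^+ n))%:E)%E.
Proof.
move=> n0.
pose T := [set w | tame 0 (scale_out R n.+1) (scale_out R n) (W w)].
pose U := [set w | overshoots 1 n (overshoot_level R n) (W w)].
pose D := [set w | overshoots (-1) n (overshoot_level R n) (W w)].
have -> : ~` [set w | half_spreads n (W w)] = ~` T `|` (~` U `|` ~` D).
  rewrite -!setCI; congr (~` _).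
  by apply/seteqP; split=> [w [? ? ?]|w [? [? ?]]]; split.
have mT : measurable (~` T).
  apply: measurableC; apply: measurable_tame => //.
  exact/ltW/scale_out_gt0.
have mU : measurable (~` U) by apply: measurableC; exact: measurable_overshoots.
have mD : measurable (~` D) by apply: measurableC; exact: measurable_overshoots.
apply: (le_trans (measureU2 _ mT (measurableU _ _ mU mD))).
rewrite EFinD; apply: leeD.
  by apply: not_tame_prob_start; exact: scale_out_gt0.
apply: (le_trans (measureU2 _ mU mD)).
rewrite (mulr_natl _ 2) mulr2n [leRHS]EFinD; apply: leeD.
  by apply: (not_overshoots_prob hW) => //; [left|exact: overshoot_level_gt0].
by apply: (not_overshoots_prob hW) => //; [right|exact: overshoot_level_gt0].
Qed.

End zigzag_estimates.

(** * Two-sided Brownian motion *)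

Section path_event_locality.
Context (R : realType).
Implicit Types (g h : R -> R).

Lemma eq_tame s T c g h : 0 <= s -> 0 <= T ->
  (forall t, 0 <= t -> g t = h t) -> tame s T c g -> tame s T c h.
Proof.
move=> s0 T0 gh tg m k km; have t0 j : 0 <= s + T * j%:R / 2 ^+ m.
  by rewrite addr_ge0// divr_ge0 ?exprn_ge0// mulr_ge0.
by rewrite -!gh//; exact: tg.
Qed.

Lemma eq_half_spreads n g h : (forall t, 0 <= t -> g t = h t) ->
  half_spreads n g -> half_spreads n h.
Proof.
move=> gh [tg [i ni gi] [j nj gj]]; split.
- by apply: (eq_tame _ _ gh) tg => //; exact/ltW/scale_out_gt0.
- by exists i => //; rewrite -gh ?sqr_ge0.
- by exists j => //; rewrite -gh ?sqr_ge0.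
Qed.

Lemma eq_collapse_right r m a g h : 0 <= r -> r <= m ->
  (forall t, 0 <= t -> g t = h t) ->
  collapse_right r m a g -> collapse_right r m a h.
Proof.
move=> r0 rm gh [g1 g2 g3 tg]; split; last first.
- by apply: (eq_tame _ _ gh) tg => //; lra.
- by rewrite -!gh//; lra.
- by rewrite -!gh//; lra.
- by rewrite -!gh//; lra.
Qed.

End path_event_locality.

Section process_sigma_events.
Context (R : realType) (d : measure_display) (Omega : measurableType d).

(** A process is measurable with respect to the sigma-algebra it generates.  So a
    path condition is an event of that sigma-algebra by the same argument that
    makes it an event of [Omega]. *)
Lemma measurable_process_sigma (D : set R) (W : Omega -> R -> R) t : D t ->
  measurable_fun (setT : set (g_sigma_algebraType
    (\bigcup_(t in D) preimage_set_system setT (W ^~ t) measurable))) (W ^~ t).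
Proof.
move=> Dt _ Y mY; apply: sub_sigma_algebra; exists t => //.
by exists Y.
Qed.

Lemma sub_process_sigma (P : probability Omega R) (D : set R) (W : Omega -> R -> R) :
  (forall t, D t -> measurable_fun setT (W ^~ t)) ->
  process_sigma D W `<=` measurable.
Proof.
move=> mW; apply: smallest_sub; first exact: sigma_algebra_measurable.
by move=> A [t Dt] [Y mY <-]; exact: mW.
Qed.

Lemma process_sigmaI (D : set R) (W : Omega -> R -> R) A A' :
  process_sigma D W A -> process_sigma D W A' -> process_sigma D W (A `&` A').
Proof.
exact: (@measurableI _ (g_sigma_algebraType
    (\bigcup_(t in D) preimage_set_system setT (W ^~ t) measurable))).
Qed.

Variables (D : set R) (W : Omega -> R -> R) (X : Omega -> R -> R).
Hypothesis WX : forall t, 0 <= t -> exists2 s, D s & W ^~ t = X ^~ s.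

Let mW t : 0 <= t -> measurable_fun (setT : set (g_sigma_algebraType
    (\bigcup_(t in D) preimage_set_system setT (X ^~ t) measurable))) (W ^~ t).
Proof. by move=> /WX[s Ds ->]; exact: measurable_process_sigma. Qed.

Lemma process_sigma_half_spreads n :
  process_sigma D X [set w | half_spreads n (W w)].
Proof. exact: (measurable_half_spreads mW n). Qed.

Lemma process_sigma_tame s T c : 0 <= s -> 0 <= T ->
  process_sigma D X [set w | tame s T c (W w)].
Proof. by move=> s0 T0; exact: (measurable_tame mW c s0 T0). Qed.

Lemma process_sigma_collapse_right r m a : 0 <= r -> r <= m ->
  process_sigma D X [set w | collapse_right r m a (W w)].
Proof. by move=> r0 rm; exact: (measurable_collapse_right mW a r0 rm). Qed.

End process_sigma_events.

Section two_sided_estimates.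
Context (R : realType) (d : measure_display) (Omega : measurableType d).
Variables (P : probability Omega R) (B : Omega -> R -> R).
Hypothesis hB : two_sided_brownian_motion P B.

Lemma two_sided_start w : B w 0 = 0.
Proof.
have [Bp [Bm [bp bm _ ->]]] := hB.
by rewrite lexx (bm_start bp).
Qed.

Lemma two_sided_branches : exists Bp Bm : Omega -> R -> R,
  [/\ brownian_motion P Bp, brownian_motion P Bm,
      independent_processes P [set t | 0 <= t]
          (fun b : bool => if b then Bp else Bm),
      (forall w t, 0 <= t -> B w t = Bp w t)
    & forall w t, 0 <= t -> (B w \o -%R) t = Bm w t].
Proof.
have [Bp [Bm [bp bm ind BE]]] := hB; exists Bp, Bm; split=> // w t t0.
  by rewrite BE t0.
rewrite /= BE oppr_ge0 opprK.
have [t0'|t0'] := leP t 0 => //.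
have -> : t = 0 by apply/eqP; rewrite eq_le t0 t0'.
by rewrite oppr0 (bm_start bp) (bm_start bm).
Qed.

(** Freezing the path at negative times makes it continuous on the whole line. *)
Lemma continuous_max0 (g : R -> R) : {within `[0, +oo[, continuous g} ->
  continuous (fun t : R => g (Num.max t 0)).
Proof.
move=> /subspace_continuousP cg t.
have t0 : `[0, +oo[%classic (Num.max t 0).
  by rewrite /= in_itv/= andbT le_max lexx orbT.
move=> U /(cg _ t0) gU.
have cm : continuous (fun s : R => Num.max s 0).
  by move=> s; apply: (@continuous_max _ _ id (cst 0)); [exact: cvg_id|exact: cvg_cst].
have gU' : \forall y \near Num.max t 0, `[0, +oo[%classic y -> U (g y) by exact: gU.
have := cm t _ gU'; rewrite /= !nbhs_simpl /=; apply: filterS => s /=; apply.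
by rewrite /= in_itv/= andbT le_max lexx orbT.
Qed.

(** Both branches vanish at 0, so a two-sided path is the sum of its branches
    frozen at their starting points. *)
Lemma two_sided_continuous : {ae P, forall w, continuous (B w)}.
Proof.
have [Bp [Bm [bp bm _ Bp_eq Bm_eq]]] := two_sided_branches.
near=> w.
have cp : {within `[0, +oo[, continuous (Bp w)}.
  by near: w; exact: (bm_continuous bp).
have cm : {within `[0, +oo[, continuous (Bm w)}.
  by near: w; exact: (bm_continuous bm).
have BE : B w = fun t => Bp w (Num.max t 0) + Bm w (Num.max (- t) 0).
  apply/funext => t; have [t0|t0] := leP 0 t.
    rewrite Bp_eq// (max_idPr _ : Num.max (- t) 0 = 0) ?oppr_le0//.
    by rewrite (bm_start bm) addr0.
  have Bt := Bm_eq w (- t); rewrite /= opprK in Bt.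
  by rewrite (bm_start bp) add0r max_l ?Bt// oppr_ge0 ltW.
rewrite BE => t; have c1 := @continuous_max0 _ cp t.
have cN : {for t, continuous (-%R : R -> R)} by exact: opp_continuous.
have c2 := continuous_comp cN (@continuous_max0 _ cm (- t)).
exact: (cvgD c1 c2).
Unshelve. all: by end_near. Qed.

Lemma process_sigma_spreads n :
  process_sigma setT B [set w | path_spreads n (B w)].
Proof.
have -> : [set w | path_spreads n (B w)] = [set w | half_spreads n (B w)] `&`
    [set w | half_spreads n ((fun w => B w \o -%R) w)].
  by apply/seteqP; split.
apply: process_sigmaI; apply: process_sigma_half_spreads => t _.
  by exists t.
by exists (- t).
Qed.

Lemma process_sigma_collapses r m a : 0 < r -> r < m ->
  process_sigma setT B [set w | path_collapses r m a (B w)].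
Proof.
move=> r0 rm.
have -> : [set w | path_collapses r m a (B w)] =
    [set w | collapse_right r m a (B w)] `&`
    [set w | tame 0 m (2 * a) ((fun w => B w \o -%R) w)].
  by apply/seteqP; split.
apply: process_sigmaI.
  by apply: process_sigma_collapse_right (ltW r0) (ltW rm) => t _; exists t.
by apply: process_sigma_tame => //; [move=> t _; exists (- t)|lra].
Qed.

Lemma two_sided_measurable t : measurable_fun setT (B ^~ t).
Proof.
have [Bp [Bm [bp bm _ Bp_eq Bm_eq]]] := two_sided_branches.
have [t0|t0] := leP 0 t.
  have -> : B ^~ t = Bp ^~ t by apply/funext => w; exact: Bp_eq.
  exact: (bm_measurable bp t0).
have t0' : 0 <= - t by lra.
have -> : B ^~ t = Bm ^~ (- t).
  by apply/funext => w; rewrite -Bm_eq//= opprK.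
exact: (bm_measurable bm t0').
Qed.

Lemma measurable_spreads n : measurable [set w | path_spreads n (B w)].
Proof.
apply: (sub_process_sigma P (fun t _ => two_sided_measurable t)).
exact: process_sigma_spreads.
Qed.

Definition half_spreads_err (n : nat) : R :=
  tame_cst R * scale_out R n.+1 ^+ 2 / scale_out R n ^+ 4
    + 2 * (64 * n%:R / 16 ^+ n + (1 - overshoot_cst R) ^+ n).

Lemma not_spreads_prob n : (0 < n)%N ->
  (P (~` [set w | path_spreads n (B w)]) <= (2 * half_spreads_err n)%:E)%E.
Proof.
move=> n0; have [Bp [Bm [bp bm _ Bp_eq Bm_eq]]] := two_sided_branches.
have -> : ~` [set w | path_spreads n (B w)] =
    ~` [set w | half_spreads n (Bp w)] `|` ~` [set w | half_spreads n (Bm w)].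
  rewrite -setCI; congr (~` _); apply/seteqP; split=> w [h1 h2]; split.
  - exact: (eq_half_spreads (Bp_eq w)).
  - exact: (eq_half_spreads (Bm_eq w)).
  - by apply: eq_half_spreads h1 => t t0; rewrite Bp_eq.
  - by apply: eq_half_spreads h2 => t t0; rewrite Bm_eq.
rewrite mulr_natl mulr2n EFinD.
have mp := measurableC (measurable_half_spreads (bm_measurable bp) n).
have mm := measurableC (measurable_half_spreads (bm_measurable bm) n).
apply: (le_trans (measureU2 _ mp mm)); apply: leeD.
  exact: (not_half_spreads_prob bp n0).
exact: (not_half_spreads_prob bm n0).
Qed.

(** The zigzag concerns one branch and the band the other one; the branches are
    independent. *)
Lemma collapses_prob (a r m : R) : 0 < a -> 0 < r -> r < m ->
  tame_cst R * m ^+ 2 / a ^+ 4 <= 1 / 2 ->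
  (zigzag_cst a r * (1 / 2)%:E * (1 / 2)%:E
    <= P [set w | path_collapses r m a (B w)])%E.
Proof.
move=> a0 r0 rm am; have [Bp [Bm [bp bm ind Bp_eq Bm_eq]]] := two_sided_branches.
pose E (b : bool) := if b then [set w | collapse_right r m a (Bp w)]
  else [set w | tame 0 m (2 * a) (Bm w)].
have m0 : 0 < m by exact: lt_trans rm.
have -> : [set w | path_collapses r m a (B w)] =
    \bigcap_(b in [set` [:: true; false]]) E b.
  apply/seteqP; split=> [w [h1 h2] [] _|w h].
  - exact: (eq_collapse_right (ltW r0) (ltW rm) (Bp_eq w)).
  - exact: (eq_tame _ (ltW m0) (Bm_eq w)).
  - split.
      have := h true; rewrite /= => /(_ isT).
      apply: eq_collapse_right (ltW r0) (ltW rm) _ => t t0.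
      by rewrite Bp_eq.
    have := h false; rewrite /= => /(_ isT).
    by apply: eq_tame (ltW m0) _ => // t t0; rewrite Bm_eq.
rewrite (ind [:: true; false] E) //; last first.
  move=> [] _ /=.
    by apply: process_sigma_collapse_right (ltW r0) (ltW rm) => t t0; exists t.
  by apply: process_sigma_tame (ltW m0) => // t t0; exists t.
rewrite big_cons big_seq1 /=; apply: lee_pmul.
- by apply: mule_ge0; [exact/ltW/zigzag_cst_gt0|rewrite lee_fin; lra].
- by rewrite lee_fin; lra.
- exact: collapse_right_prob.
apply: tame_prob_half => //; first lra.
apply: le_trans am; have c0 : 0 < tame_cst R * m ^+ 2.
  by rewrite /tame_cst !mulr_gt0 ?exprn_gt0.
rewrite ler_pM2l// lef_pV2 ?posrE ?exprn_gt0//; last lra.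
by rewrite ler_pXn2r ?nnegrE//; lra.
Qed.

End two_sided_estimates.

(** * Disjoint blocks of independent events *)

Section independent_blocks.
Context (R : realType) (d : measure_display) (Omega : measurableType d).
Variables (P : probability Omega R) (Y : nat -> set Omega) (p : nat -> R).
Hypothesis mY : forall i, measurable (Y i).
Hypothesis indepY : forall s, uniq s ->
  P (\bigcap_(i in [set` s]) Y i) = (\prod_(i <- s) p i)%:E.

Lemma measurable_bigcap_seq (s : seq nat) :
  measurable (\bigcap_(i in [set` s]) Y i).
Proof. by apply: fin_bigcap_measurable => [|i _]; [exact: finite_seq|]. Qed.

(** Induction on the number of blocks: [P (~ Z & E) = P E - P (Z & E)], and in the
    last term the indices of the block [Z] join those of [t]. *)
Lemma block_complements_prob (ss : seq (seq nat)) (t : seq nat) :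
  uniq (flatten ss ++ t) ->
  P (\big[setI/setT]_(b <- ss) ~` (\bigcap_(i in [set` b]) Y i)
     `&` \bigcap_(i in [set` t]) Y i)
  = (\prod_(b <- ss) (1 - \prod_(i <- b) p i) * \prod_(i <- t) p i)%:E.
Proof.
elim: ss t => [|b ss IH] t /= ut.
  by rewrite !big_nil setTI mul1r indepY.
rewrite !big_cons.
set A := \big[setI/setT]_(b <- ss) _; set Z := \bigcap_(i in [set` b]) Y i.
set V := \bigcap_(i in [set` t]) Y i.
have mA : measurable A.
  by apply: bigsetI_measurable => c _; exact/measurableC/measurable_bigcap_seq.
have -> : ~` Z `&` A `&` V = (A `&` V) `\` Z.
  by rewrite setDE -[LHS]setIA [LHS]setIC.
have PAV : P (A `&` V) = (\prod_(b <- ss) (1 - \prod_(i <- b) p i)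
    * \prod_(i <- t) p i)%:E.
  apply: IH; move: ut; rewrite -catA cat_uniq => /and3P[_ _].
  by rewrite cat_uniq.
have PAVZ : P (A `&` V `&` Z) = (\prod_(b <- ss) (1 - \prod_(i <- b) p i)
    * (\prod_(i <- b) p i * \prod_(i <- t) p i))%:E.
  have -> : A `&` V `&` Z = A `&` \bigcap_(i in [set` b ++ t]) Y i.
    rewrite -setIA; congr (_ `&` _); rewrite setIC.
    apply/seteqP; split=> [w [Zw Vw] i|w h].
      by rewrite /= mem_cat => /orP[]; [exact: Zw|exact: Vw].
    by split=> i /= ib; apply: h; rewrite /= mem_cat ib ?orbT.
  rewrite IH ?big_cat//.
  by rewrite uniq_catCA catA.
have mAV : measurable (A `&` V) by apply: measurableI => //; exact: measurable_bigcap_seq.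
have mZ : measurable Z by exact: measurable_bigcap_seq.
have PD : P ((A `&` V) `\` Z) = (P (A `&` V) - P (A `&` V `&` Z))%E.
  by apply: measureD => //; rewrite -ge0_fin_numE// fin_num_measure.
rewrite PD PAV PAVZ -EFinB; congr (_%:E); ring.
Qed.

Variables (b : nat -> seq nat) (c : R).
Hypothesis ub : forall N K, uniq (flatten [seq b k | k <- iota N K]).
Hypothesis c_gt0 : 0 < c.
Hypothesis pb : forall k, c <= \prod_(i <- b k) p i.

(** The second Borel-Cantelli lemma: [K] consecutive blocks all fail with
    probability at most [(1 - c) ^ K]. *)
Lemma frequently_block : P.-negligible
  (~` [set w | forall N, exists2 k, (N <= k)%N & (\bigcap_(i in [set` b k]) Y i) w]).
Proof.
pose Z k := \bigcap_(i in [set` b k]) Y i.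
have mZ k : measurable (Z k) by exact: measurable_bigcap_seq.
have p01 s : uniq s -> 0 <= \prod_(i <- s) p i <= 1.
  by move=> us; rewrite -!lee_fin -indepY// measure_ge0 probability_le1//;
    exact: measurable_bigcap_seq.
have ubk k : uniq (b k) by have := ub k 1; rewrite /= cats0.
have c1 : c <= 1 by have /andP[_] := p01 _ (ubk 0%N); exact: le_trans (pb 0%N).
pose N_ N := \bigcap_(k in [set k | (N <= k)%N]) ~` Z k.
have mN N : measurable (N_ N).
  by apply: bigcap_measurableType => k _; exact: measurableC.
have PN N : P (N_ N) = 0%E.
  apply/eqP; rewrite eq_le measure_ge0 andbT.
  have le_pow K : (P (N_ N) <= ((1 - c) ^+ K)%:E)%E.
    have := @block_complements_prob [seq b k | k <- iota N K] [::].
    rewrite cats0 big_nil mulr1 => /(_ (ub N K)).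
    rewrite (_ : \bigcap_(i in _) _ = setT); last by apply/seteqP; split.
    rewrite setIT => PE.
    apply: (@le_trans _ _ (P (\big[setI/setT]_(b <- [seq b k | k <- iota N K])
       ~` (\bigcap_(i in [set` b]) Y i)))).
      apply: le_measure; rewrite ?inE//.
        rewrite big_map; apply: bigsetI_measurable => k _.
        exact: (measurableC (mZ k)).
      rewrite big_map -bigcap_seq => w Nw k /=.
      by rewrite mem_iota => /andP[Nk _]; exact: Nw.
    rewrite PE lee_fin big_map.
    have -> : (1 - c) ^+ K = \prod_(k <- iota N K) (1 - c).
      by rewrite big_const_seq count_predT size_iota iter_mulr_1.
    apply: ler_prod => k _; have /andP[_ p1] := p01 _ (ubk k).
    by have := pb k; lra.
  apply/lee_addgt0Pr => e e0; rewrite add0e.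
  have [K _ hK] : \forall K \near \oo, (1 - c) ^+ K < e.
    have := @cvg_geometric R 1 (1 - c); rewrite ger0_norm ?subr_ge0//.
    rewrite gtrBl => /(_ c_gt0) /cvgrPdist_lt /(_ _ e0); apply: filterS => K.
    by rewrite sub0r normrN /geometric/= mul1r; exact/le_lt_trans/ler_norm.
  apply: le_trans (le_pow K) _; rewrite lee_fin; apply/ltW/hK => /=; exact: leqnn.
apply: (@negligibleS _ _ _ _ (\bigcup_N N_ N)).
  move=> w /= /existsNP[N hN]; exists N => // k /= Nk Zw.
  by apply: hN; exists k.
apply: negligible_bigcup => N.
by apply/(negligibleP P (mN N)); exact: PN.
Qed.

End independent_blocks.

(** The union bound for independent events. *)
Lemma prod_ge_1_sum (R : realType) (I : eqType) (s : seq I) (p e : I -> R) :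
  (forall i, 0 <= p i <= 1) -> {in s, forall i, 1 - e i <= p i} ->
  1 - \sum_(i <- s) e i <= \prod_(i <- s) p i.
Proof.
move=> p01; elim: s => [|i s IH] pe; first by rewrite !big_nil subr0.
rewrite !big_cons; have /andP[pi0 pi1] := p01 i.
have {}IH := IH (fun j js => pe j (mem_behead (s := i :: s) js)).
have pp : 0 <= \prod_(j <- s) p j <= 1.
  apply: (big_ind (fun x => 0 <= x <= 1)) => // [|x y]; first lra.
  by move=> /andP[x0 x1] /andP[y0 y1]; rewrite mulr_ge0 //= mulr_ile1.
have := pe i (mem_head _ _); nra.
Qed.

(** * Pinching occurs infinitely often *)

Section error_rate.
Context (R : realType).

Lemma overshoot_cst_le1 : overshoot_cst R <= 1.
Proof.
rewrite -lee_fin.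
apply: (le_trans (@normal_prob_overshoot R 1 1 1 _ _ _ _)); [by left|lra|lra|lra|].
by apply: probability_le1; exact: measurable_scaled_ge.
Qed.

Definition rate : R := Num.max (1 / 2) (1 - overshoot_cst R).

Lemma rate_gt0 : 0 < rate.
Proof. by rewrite lt_max; apply/orP; left; lra. Qed.

Lemma rate_lt1 : rate < 1.
Proof.
by have := overshoot_cst_gt0 R; rewrite gt_max; move=> ?; apply/andP; split; lra.
Qed.

Definition rate_cst : R := 2 * (16 * tame_cst R + 130).

Lemma rate_cst_gt0 : 0 < rate_cst.
Proof.
have : 0 < tame_cst R by rewrite mulr_gt0// exprn_gt0.
by rewrite /rate_cst; lra.
Qed.

(** All terms are compared with powers of [x = 2 ^ n]. *)
Lemma spreads_err_le n : 2 * half_spreads_err R n <= rate_cst * rate ^+ n.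
Proof.
have r0 := rate_gt0.
have h1 : (1 / 2) ^+ n <= rate ^+ n.
  by apply: lerXn2r; rewrite ?nnegrE ?le_max ?lexx//; lra.
have h2 : (1 - overshoot_cst R) ^+ n <= rate ^+ n.
  have := overshoot_cst_le1 => ?.
  by apply: lerXn2r; rewrite ?nnegrE ?le_max ?lexx ?orbT//; lra.
have C0 : 0 < tame_cst R by rewrite mulr_gt0// exprn_gt0.
pose x : R := 2 ^+ n.
have x1 : 1 <= x by rewrite exprn_ege1// ler1n.
have nx : n%:R <= x by rewrite /x -natrX ler_nat; exact/ltnW/ltn_expl.
have x3 : x <= x ^+ 3 by rewrite -[leLHS]expr1 ler_weXn2l.
have e4 : 4 ^+ n = x ^+ 2 :> R.
  by rewrite /x -exprM mulnC exprM; congr (_ ^+ _); rewrite -natrX.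
have e16 : 16 ^+ n = x ^+ 4 :> R.
  by rewrite /x -exprM mulnC exprM; congr (_ ^+ _); rewrite -natrX.
have eh : (1 / 2) ^+ n = x^-1 by rewrite div1r exprVn.
have x0 : 0 < x by lra.
have t1 : tame_cst R * scale_out R n.+1 ^+ 2 / scale_out R n ^+ 4
    <= 16 * tame_cst R * rate ^+ n.
  have -> : tame_cst R * scale_out R n.+1 ^+ 2 / scale_out R n ^+ 4
      = 16 * tame_cst R * (x ^+ 4)^-1.
    by rewrite /scale_out (exprS 4) e4; field; rewrite gt_eqF.
  apply: ler_wpM2l; first lra.
  apply: le_trans h1; rewrite eh lef_pV2 ?posrE ?exprn_gt0//.
  by apply: (le_trans x3); rewrite ler_weXn2l.
have t2 : n%:R / 16 ^+ n <= rate ^+ n.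
  apply: le_trans h1; rewrite eh e16 ler_pdivrMr ?exprn_gt0//.
  have -> : x^-1 * x ^+ 4 = x ^+ 3 by field; rewrite gt_eqF.
  exact: le_trans nx x3.
by rewrite /half_spreads_err /rate_cst; lra.
Qed.

Lemma geometric_small (C e : R) : 0 < e ->
  exists2 n, (4 <= n)%N & C * rate ^+ n < e.
Proof.
move=> e0; have := @cvg_geometric R C rate.
rewrite ger0_norm ?(ltW rate_gt0)// => /(_ rate_lt1).
move=> /cvgrPdist_lt /(_ _ e0)[n _ hn]; exists (n + 4)%N; first lia.
have := hn (n + 4)%N; rewrite /= leq_addr sub0r normrN /geometric/= => /(_ isT).
exact/le_lt_trans/ler_norm.
Qed.

End error_rate.

Lemma scale_in_cvg (R : realType) n0 : scale_in R (n0 + n) @[n --> \oo] --> (0 : R).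
Proof.
have g0 : geometric 1 (1 / 2 : R) @ \oo --> (0 : R).
  by apply: cvg_geometric; rewrite ger0_norm; lra.
apply: (squeeze_cvgr _ (cvg_cst 0) g0); apply: nearW => n.
rewrite (ltW (scale_in_gt0 _ _))//= mul1r div1r exprVn.
by rewrite lef_pV2 ?posrE ?exprn_gt0// ler_weXn2l ?ler1n//; nia.
Qed.

Lemma scale_out_cvg (R : realType) n0 : scale_out R (n0 + n) @[n --> \oo] --> +oo.
Proof.
apply/cvgryPge => x; near=> n.
have xn : x <= n%:R by near: n; exact: nbhs_infty_ger.
apply: (le_trans xn); rewrite /scale_out -natrX ler_nat.
by apply: leq_trans (leq_addl n0 n) _; exact/ltnW/ltn_expl.
Unshelve. all: by end_near. Qed.

Section dyadic_blocks.

Definition dyadic_block k := index_iota (2 ^ k) (2 ^ k.+1).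

Lemma trunc_log_dyadic_block k i : i \in iota (2 ^ k).+1 (2 ^ k - 1) ->
  trunc_log 2 i = k /\ (2 ^ k < i)%N.
Proof.
rewrite mem_iota => /andP[ki ik]; split=> //.
by apply: trunc_log_eq => //; rewrite expnS; lia.
Qed.

Lemma dyadic_block_cons k :
  dyadic_block k = (2 ^ k)%N :: iota (2 ^ k).+1 (2 ^ k - 1).
Proof.
rewrite /dyadic_block /index_iota; have k2 : (0 < 2 ^ k)%N by rewrite expn_gt0.
by have -> : (2 ^ k.+1 - 2 ^ k = (2 ^ k - 1).+1)%N by rewrite expnS; lia.
Qed.

Lemma flatten_dyadic_blocks N K :
  flatten [seq dyadic_block k | k <- iota N K] = index_iota (2 ^ N) (2 ^ (N + K)).
Proof.
elim: K N => [|K IH] N /=; first by rewrite addn0 /index_iota subnn.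
rewrite IH /dyadic_block /index_iota addSnnS.
have h1 : (2 ^ N <= 2 ^ N.+1)%N by rewrite leq_exp2l.
have h2 : (2 ^ N.+1 <= 2 ^ (N + K.+1))%N by rewrite leq_exp2l// -addSnnS leq_addr.
rewrite -[in X in _ ++ iota X _](subnKC h1) -iotaD; congr (iota _ _); lia.
Qed.

Lemma uniq_dyadic_blocks N K : uniq (flatten [seq dyadic_block k | k <- iota N K]).
Proof. by rewrite flatten_dyadic_blocks iota_uniq. Qed.

End dyadic_blocks.

Section independent_brownian_paths.
Context (R : realType) (d : measure_display) (Omega : measurableType d).
Variables (P : probability Omega R) (B : nat -> Omega -> R -> R).
Hypothesis B_bm : forall n, two_sided_brownian_motion P (B n).
Hypothesis B_indep : independent_processes P setT B.

Section fixed_scale.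
Variables (n0 : nat) (a : R).
Hypothesis n0_ge4 : (4 <= n0)%N.
Hypothesis n0_large : rate_cst R / (1 - rate R) * rate R ^+ n0 < 1 / 2.
Hypothesis a_gt0 : 0 < a.
Hypothesis a_large : tame_cst R * scale_out R n0 ^+ 2 / a ^+ 4 <= 1 / 2.

Let r := scale_in R n0.
Let m := scale_out R n0.

Let r_gt0 : 0 < r. Proof. exact: scale_in_gt0. Qed.

Let rm : r < m.
Proof.
apply: (@lt_le_trans _ _ 1).
  by rewrite invf_lt1 ?exprn_gt0// exprn_egt1 ?ltr1n//; lia.
by rewrite exprn_ege1// ler1n.
Qed.

(** The [i]-th path of the sequence serves in the block of index [trunc_log 2 i]
    only.  The first path of a block has to collapse; the following ones have to
    spread, at scales given by their distance to the first one. *)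
Definition block_event (i : nat) : set Omega :=
  let k := trunc_log 2 i in
  if i == (2 ^ k)%N then [set w | path_collapses r m a (B i w)]
  else [set w | path_spreads (n0 + (i - (2 ^ k).+1)) (B i w)].

Lemma process_sigma_block_event i : process_sigma setT (B i) (block_event i).
Proof.
rewrite /block_event; case: ifP => _.
  exact: process_sigma_collapses.
exact: process_sigma_spreads.
Qed.

Lemma measurable_block_event i : measurable (block_event i).
Proof.
apply: (sub_process_sigma P (fun t _ => two_sided_measurable (B_bm i) t)).
exact: process_sigma_block_event.
Qed.

Let p i : R := fine (P (block_event i)).

Let pE i : P (block_event i) = (p i)%:E.
Proof. by rewrite fineK// fin_num_measure//; exact: measurable_block_event. Qed.

Let p01 i : 0 <= p i <= 1.
Proof.
by rewrite -!lee_fin -pE measure_ge0 probability_le1//; exact: measurable_block_event.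
Qed.

Lemma block_events_indep s : uniq s ->
  P (\bigcap_(i in [set` s]) block_event i) = (\prod_(i <- s) p i)%:E.
Proof.
move=> us; rewrite (B_indep us (fun i _ => @process_sigma_block_event i)).
by rewrite -prodEFin; apply: eq_bigr => i _; rewrite pE.
Qed.

Lemma spreads_prob n i : (0 < n)%N ->
  (P (~` [set w | path_spreads n (B i w)]) <= (rate_cst R * rate R ^+ n)%:E)%E.
Proof.
move=> ngt0; apply: (le_trans (not_spreads_prob (B_bm i) ngt0)).
by rewrite lee_fin spreads_err_le.
Qed.

(** The collapse of the first path has a fixed positive probability, and the other
    conditions of the block fail with total probability at most 1/2, whatever
    the length of the block. *)
Lemma block_prob : exists2 c, 0 < c &
  forall k, c <= \prod_(i <- dyadic_block k) p i.
Proof.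
pose z := (zigzag_cst a r * (1 / 2)%:E * (1 / 2)%:E)%E.
have z0 : (0 < z)%E.
  have h : (0 < (1 / 2)%:E :> \bar R)%E by rewrite lte_fin; lra.
  apply: mule_gt0 => //; apply: mule_gt0 => //; exact: zigzag_cst_gt0.
have zp i : (z <= P [set w | path_collapses r m a (B i w)])%E.
  exact: (collapses_prob (B_bm i)).
have zfin : z \is a fin_num.
  rewrite ge0_fin_numE ?(ltW z0)//; apply: le_lt_trans (zp 0%N) _.
  rewrite -ge0_fin_numE// fin_num_measure//.
  apply: (sub_process_sigma P (fun t _ => two_sided_measurable (B_bm 0%N) t)).
  exact: process_sigma_collapses.
have cz : 0 < fine z by rewrite fine_gt0// z0 -ge0_fin_numE ?(ltW z0).
exists (fine z * (1 / 2)); first by rewrite mulr_gt0//; lra.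
move=> k; rewrite dyadic_block_cons big_cons; apply: ler_pM.
- exact: ltW.
- by lra.
- rewrite -lee_fin -pE fineK// /block_event trunc_expnK// eqxx; exact: zp.
pose e i := rate_cst R * rate R ^+ (n0 + (i - (2 ^ k).+1)).
have C0 := rate_cst_gt0 R; have r0 := rate_gt0 R; have r1 := rate_lt1 R.
have pe i : i \in iota (2 ^ k).+1 (2 ^ k - 1) -> 1 - e i <= p i.
  move=> /trunc_log_dyadic_block[tk ki].
  rewrite -lee_fin -pE /block_event tk (gtn_eqF ki).
  rewrite -[X in P X]setCK probability_setC; last first.
    apply: measurableC; exact: measurable_spreads (B_bm i) _.
  rewrite EFinB; apply: leeB => //; apply: spreads_prob.
  by rewrite addn_gt0 (leq_trans _ n0_ge4).
apply: le_trans (_ : 1 - \sum_(i <- iota (2 ^ k).+1 (2 ^ k - 1)) e i <= _); last first.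
  by apply: prod_ge_1_sum => i; [exact: p01|exact: pe].
suff : \sum_(i <- iota (2 ^ k).+1 (2 ^ k - 1)) e i <= 1 / 2 by lra.
apply: le_trans (ltW n0_large).
rewrite -[X in iota X _]addn0 iotaDl big_map -/(index_iota 0 _).
have -> : \sum_(i <- iota 0 (2 ^ k - 1)) e ((2 ^ k).+1 + i)%N
    = series (geometric (rate_cst R * rate R ^+ n0) (rate R)) (2 ^ k - 1)%N.
  rewrite /series/= /index_iota subn0; apply: eq_bigr => i _.
  by rewrite /e addKn exprD mulrA.
rewrite [leRHS]mulrAC; apply: geometric_le_lim => //.
  by rewrite mulr_ge0 ?exprn_ge0// ltW.
by rewrite ger0_norm// ltW.
Qed.

(** The conditions of a pinching place at [2 ^ k] that involve the paths beyond the
    block of index [k]. *)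
Definition tail_failure (k : nat) : set Omega :=
  \bigcup_i ~` [set w | path_spreads (n0 + (2 ^ k - 1 + i))
                         (B ((2 ^ k).+1 + (2 ^ k - 1 + i)) w)].

Lemma measurable_tail_failure k : measurable (tail_failure k).
Proof.
apply: bigcupT_measurable => i; apply: measurableC.
exact: (measurable_spreads (B_bm _)).
Qed.

Lemma tail_failure_prob k : (P (tail_failure k)
  <= (rate_cst R * rate R ^+ n0 / (1 - rate R) * rate R ^+ k)%:E)%E.
Proof.
have C0 := rate_cst_gt0 R; have r0 := rate_gt0 R; have r1 := rate_lt1 R.
have msp n i : measurable (~` [set w | path_spreads n (B i w)]).
  by apply: measurableC; exact: (measurable_spreads (B_bm _)).
have k2 : (k <= 2 ^ k - 1)%N by have := ltn_expl k (leqnn 2); lia.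
apply: (@le_trans _ _ (\sum_(i <oo) P (~` [set w | path_spreads
    (n0 + (2 ^ k - 1 + i)) (B ((2 ^ k).+1 + (2 ^ k - 1 + i)) w)]))%E).
  apply: generalized_Boole_inequality; first by move=> i; exact: msp.
  exact: measurable_tail_failure.
apply: (le_trans (@geometric_eseries_le R _
    (rate_cst R * rate R ^+ (n0 + (2 ^ k - 1))) (rate R) _ _ _ _)) => //.
- by rewrite mulr_ge0 ?exprn_ge0 ?(ltW C0) ?(ltW r0).
- by rewrite r0 r1.
- move=> i; apply: (le_trans (spreads_prob _ _)).
    by rewrite addn_gt0 (leq_trans _ n0_ge4).
  by rewrite lee_fin addnA (exprD _ _ i) mulrA.
rewrite lee_fin exprD.
have -> : rate_cst R * (rate R ^+ n0 * rate R ^+ (2 ^ k - 1)) / (1 - rate R)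
    = rate_cst R * rate R ^+ n0 / (1 - rate R) * rate R ^+ (2 ^ k - 1).
  by rewrite mulrA mulrAC.
apply: ler_wpM2l.
  rewrite divr_ge0 ?subr_ge0 ?(ltW r1)// mulr_ge0 ?exprn_ge0 ?(ltW C0)//.
  exact: ltW.
by apply: ler_wiXn2l => //; exact: ltW.
Qed.

(** The first Borel-Cantelli lemma. *)
Lemma finitely_many_tail_failures : P.-negligible (lim_sup_set tail_failure).
Proof.
have C0 := rate_cst_gt0 R; have r0 := rate_gt0 R; have r1 := rate_lt1 R.
apply/negligibleP.
  apply: bigcap_measurableType => n _; apply: bigcup_measurable => k _.
  exact: measurable_tail_failure.
apply: lim_sup_set_cvg0; first exact: measurable_tail_failure.
apply: le_lt_trans (geometric_eseries_le _ _ _ tail_failure_prob) _ => //.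
- rewrite divr_ge0 ?subr_ge0 ?(ltW r1)// mulr_ge0 ?exprn_ge0 ?(ltW C0)//.
  exact: ltW.
- by rewrite r0 r1.
exact: ltry.
Qed.

Lemma block_pinching w k : (forall n, continuous (B n w)) ->
  (\bigcap_(i in [set` dyadic_block k]) block_event i) w ->
  ~ tail_failure k w ->
  pinching (fun i => scale_in R (n0 + i)) (fun i => scale_out R (n0 + i))
    (fun n => B n w) (2 ^ k).
Proof.
move=> cB blockw tailw.
have B0 n : B n w 0 = 0 by exact: two_sided_start (B_bm n) w.
have in_block i : i \in dyadic_block k -> block_event i w by move=> ?; exact: blockw.
split.
  have := in_block (2 ^ k)%N; rewrite dyadic_block_cons mem_head => /(_ isT).
  rewrite /block_event trunc_expnK// eqxx addn0 => h.
  exact: (path_collapses_image (cB _) (B0 _) a_gt0 r_gt0 rm h).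
move=> i; rewrite addnS; apply: path_spreads_spreads => //.
  by rewrite (leq_trans n0_ge4)// leq_addr.
have [ik|ki] := ltnP i (2 ^ k - 1).
  have ib : (2 ^ k).+1 + i \in iota (2 ^ k).+1 (2 ^ k - 1).
    by rewrite mem_iota leq_addr ltn_add2l.
  have [tk lt] := trunc_log_dyadic_block ib.
  have := in_block ((2 ^ k).+1 + i)%N.
  rewrite dyadic_block_cons in_cons ib orbT => /(_ isT).
  by rewrite /block_event tk (gtn_eqF lt) addKn.
apply: contrapT => nsp; apply: tailw; exists (i - (2 ^ k - 1))%N => //=.
by rewrite subnKC.
Qed.

Lemma ae_frequently_pinching : {ae P, forall w,
  (forall n, continuous (B n w)) /\
  forall N, exists2 j, (N <= j)%N &
    pinching (fun i => scale_in R (n0 + i)) (fun i => scale_out R (n0 + i))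
      (fun n => B n w) j}.
Proof.
have [c c0 cp] := block_prob.
have freq := frequently_block measurable_block_event block_events_indep
  uniq_dyadic_blocks c0 cp.
have cont : \forall w \ae P, forall n, continuous (B n w).
  by apply: ae_foralln => n; exact: (two_sided_continuous (B_bm n)).
apply: negligibleS (negligibleU (negligibleU cont freq) finitely_many_tail_failures).
move=> w /= nw; apply: contrapT => /not_orP[/not_orP[]].
move=> /contrapT cw /contrapT fw tw; apply: nw; split=> // N.
have [n ntail] : exists n, forall k, (n <= k)%N -> ~ tail_failure k w.
  move: tw => /existsNP[n /not_implyP[_ h]]; exists n => k nk tk.
  by apply: h; exists k.
have [k Nk bk] := fw (maxn n N).
exists (2 ^ k)%N; first by have := ltn_expl k (leqnn 2); lia.
by apply: block_pinching => //; apply: ntail; lia.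
Qed.

End fixed_scale.

(** Any level [a >= 1] with [a >= 2 * tame_cst * m ^ 2] works. *)
Lemma collapse_level_exists (m : R) :
  exists2 a : R, 0 < a & tame_cst R * m ^+ 2 / a ^+ 4 <= 1 / 2.
Proof.
have C0 : 0 < tame_cst R by rewrite mulr_gt0// exprn_gt0.
have x0 : 0 <= tame_cst R * m ^+ 2 by rewrite mulr_ge0 ?sqr_ge0// ltW.
exists (1 + 2 * (tame_cst R * m ^+ 2)); first lra.
set x := tame_cst R * m ^+ 2 in x0 *.
have y1 : 1 <= 1 + 2 * x by lra.
have y4 : 1 + 2 * x <= (1 + 2 * x) ^+ 4.
  by rewrite -[leLHS]expr1 ler_weXn2l.
rewrite ler_pdivrMr; last by rewrite exprn_gt0//; lra.
by lra.
Qed.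
End independent_brownian_paths.

Theorem theorem1 (R : realType) (d : measure_display)
    (Omega : measurableType d) (P : probability Omega R)
    (B : nat -> Omega -> R -> R)
    (B_bm : forall n, two_sided_brownian_motion P (B n))
    (B_indep : independent_processes P setT B) :
  {ae P, forall w : Omega,
    [/\ forall n, continuous (B n w),
        determines_nondegenerate_continuum (fun n => B n w)
      & indecomposable_continuum (determined_continuum (fun n => B n w))]}.
Proof.
have h2 : 0 < 1 / 2 :> R by lra.
have [n0 n0_ge4 n0_large] := geometric_small (rate_cst R / (1 - rate R)) h2.
have [a a_gt0 a_large] := collapse_level_exists (scale_out R n0).
apply: negligibleS (ae_frequently_pinching B_bm B_indep n0_ge4 n0_large a_gt0 a_large).
apply: subsetC => w /= [cB pB].
have D_gt0 i : 0 < scale_in R (n0 + i) by exact: scale_in_gt0.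
have [det indec] := frequently_pinching_indecomposable cB
  (fun n => two_sided_start (B_bm n) w) D_gt0 (scale_in_cvg n0) (scale_out_cvg n0) pB.
by split.
Qed.
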